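(* Let $G=(V,E)$ be a loopless graph with possible multiple edges. Then $\tau(G,q)$ and $\bar\tau(G,q)$ are polynomial functions of degree $r(G)$ in positive integers $q$, and (writing $\tau(G,t)$, $\bar\tau(G,t)$ for the corresponding polynomials in $t$) can be written as $$\tau(G,t)=\sum_{[\varepsilon]\in[A\mathcal O(G)]}\tau_{\mathbb Z}(G,\varepsilon;t),\qquad \bar\tau(G,t)=\sum_{[\varepsilon]\in[A\mathcal O(G)]}\bar\tau_{\mathbb Z}(G,\varepsilon;t),$$ where in each sum $\varepsilon$ is any representative of the class $[\varepsilon]$, and they satisfy the reciprocity law $$\tau(G,-t)=(-1)^{r(G)}\bar\tau(G,t).$$ In particular, $(-1)^{r(G)}\tau(G,0)$ is the number of cut-equivalence classes of acyclic orientations of $G$.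
   Context: Graphs are finite. $r(G)=|V|-k(G)$, where $k(G)$ is the number of connected components of $G$. An orientation $\varepsilon$ of $G$ assigns an arrow $\varepsilon(x)$ to each edge $x$ (two choices for an edge with two distinct endpoints). $\mathcal O(G)$ is the set of orientations of $G$. A circuit is a connected subgraph with degree 2 at every vertex (two parallel edges form a circuit); a direction of a circuit $C$ is an orientation $\varepsilon_C$ of $C$ with one arrow in and one arrow out at every vertex. An orientation $\varepsilon$ of $G$ is acyclic if there is no circuit $C$ on which the restriction of $\varepsilon$ is a direction of $C$. $A\mathcal O(G)$ is the set of acyclic orientations of $G$. For orientations $\varepsilon_i$ of subgraphs $H_i$ of $G$ ($i=1,2$), the coupling $[\varepsilon_1,\varepsilon_2]:E\to\mathbb Z$ is $1$ at $x\in E(H_1)\cap E(H_2)$ if $\varepsilon_1(x)=\varepsilon_2(x)$, $-1$ at $x\in E(H_1)\cap E(H_2)$ if $\varepsilon_1(x)\ne\varepsilon_2(x)$, and $0$ otherwise. For an abelian group $A$, a tension of $(G,\varepsilon)$ with values in $A$ is $f:E\to A$ such that $\sum_{x\in C}[\varepsilon,\varepsilon_C](x)f(x)=0$ for every circuit $C$ of $G$ with direction $\varepsilon_C$; $T(G,\varepsilon;A)$ is the group of all such tensions. It is nowhere-zero if $f(x)\neq0$ for all $x\in E$. For a positive integer $q$, $\tau(G,q)$ is the number of nowhere-zero tensions of $(G,\varepsilon)$ with values in an abelian group $A$ of order $q$ (this number does not depend on the choice of $\varepsilon$ or of $A$). Cuts: for a partition $\{S,T\}$ of $V$, the cut $[S,T]$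 is the set of all edges between $S$ and $T$. A bond is a minimal (nonempty) cut. A cut $[S,T]$ is directed with respect to $\varepsilon$ if all its edges have arrows from $S$ to $T$ or all have arrows from $T$ to $S$; a directed bond is a minimal (nonempty) directed cut. A cut is oriented (with respect to $\varepsilon$) if it is a disjoint union of directed bonds. Two orientations $\varepsilon,\varrho\in\mathcal O(G)$ are cut-equivalent, $\varepsilon\sim\varrho$, if $E(\varepsilon\ne\varrho)=\{x\in E:\varepsilon(x)\ne\varrho(x)\}$ is empty or is an oriented cut with respect to either $\varepsilon$ or $\varrho$. This is an equivalence relation on $\mathcal O(G)$, and any orientation cut-equivalent to an acyclic one is acyclic; $[A\mathcal O(G)]$ is the set of cut-equivalence classes $[\varepsilon]$ of acyclic orientations. For a positive integer $q$, $$\bar\tau(G,q)=\#\{([\varepsilon],f):[\varepsilon]\in[A\mathcal O(G)],\ f\in T(G,\varepsilon;\mathbb Z),\ 0\le f(x)\le q\ \forall x\in E\},$$ where for each class one fixes a representative $\varepsilon\in[\varepsilon]$ (the count does not depend on the choice). For $\varepsilon\in A\mathcal O(G)$, let $\bar\Delta^+(G,\varepsilon)=\{f\in T(G,\varepsilon;\mathbb R):0\le f(x)\le1\ \forall x\in E\}$ (equivalently, the convex hull of the $0$-$1$ valued tensions) and let $\Delta^+(G,\varepsilon)=\{f\in T(G,\varepsilon;\mathbb R):0<f(x)<1\ \forall x\in E\}$ be its interior in $T(G,\varepsilon;\mathbb R)$. $\tau_{\mathbb Z}(G,\varepsilon;t)$ and $\bar\tau_{\mathbb Z}(G,\varepsilon;t)$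 are the Ehrhart polynomials of $\Delta^+(G,\varepsilon)$ and $\bar\Delta^+(G,\varepsilon)$, i.e. the polynomials with $\tau_{\mathbb Z}(G,\varepsilon;q)=|q\Delta^+(G,\varepsilon)\cap\mathbb Z^E|$ and $\bar\tau_{\mathbb Z}(G,\varepsilon;q)=|q\bar\Delta^+(G,\varepsilon)\cap\mathbb Z^E|$ for all positive integers $q$; for acyclic $\varepsilon$ they depend only on $[\varepsilon]$. *)

(* Defs.v *)
From HB Require Import structures.
From mathcomp Require Import all_boot all_order all_algebra.

Set Implicit Arguments.
Unset Strict Implicit.
Unset Printing Implicit Defensive.

Import Order.TTheory GRing.Theory Num.Theory.

Local Open Scope ring_scope.

(* Finite multigraphs: each edge carries the unordered set of its endpoints,
   a singleton when the edge is a loop. *)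
Record mgraph := MGraph {
  vert : finType;
  edge : finType;
  ends : edge -> {set vert};
  ends_card : forall x : edge, (0 < #|ends x| <= 2)%N
}.

Definition loopless (G : mgraph) : Prop :=
  forall x : edge G, #|ends x| = 2.

Section Graph.

Variable G : mgraph.

Local Notation V := (vert G).
Local Notation E := (edge G).

Implicit Types (A B C D : {set E}) (S : {set V}) (u v : V) (x : E).

(* Subgraphs are given by their edge sets; the vertices of C are those incident
   to an edge of C. This loses nothing for circuits, which have no isolated
   vertex. *)
Definition incident C v : bool := [exists x in C, v \in ends x].

Definition adj C : rel V := fun u v => [exists x in C, ends x == [set u; v]].

Definition k_comp : nat := n_comp (adj [set: E]) predT.

Definition rk : nat := #|V| - k_comp.

(* A loop contributes 2 to the degree of its endpoint. *)
Definition degree C v : nat :=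
  \sum_(x in C | v \in ends x) (if #|ends x| == 1%N then 2 else 1)%N.

Definition is_circuit C : bool :=
  [&& C != set0,
      [forall v, incident C v ==> (degree C v == 2)] &
      [forall u, forall v,
         incident C u ==> incident C v ==> connect (adj C) u v]].

(* The arrow (u, v) points from u to v. An arrow assignment orients the subgraph
   with edge set C when it orients every edge of C; its values off C are
   irrelevant. *)
Definition arrows := {ffun E -> V * V}.

Implicit Types d : arrows.

Definition orients C d : bool :=
  [forall x in C, [set (d x).1; (d x).2] == ends x].

Definition orientation := {d : arrows | orients [set: E] d}.

Implicit Types e r : orientation.

Definition arr e : arrows := val e.

Definition is_direction C d : bool :=
  orients C d &&
  [forall v, incident C v ==>
     (#|[set x in C | (d x).2 == v]| == 1%N) &&
     (#|[set x in C | (d x).1 == v]| == 1%N)].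

Definition is_acyclic e : bool :=
  [forall C, is_circuit C ==> ~~ is_direction C (arr e)].

Definition acyclics : {set orientation} := [set e | is_acyclic e].

(* [d1, d2] for orientations d1, d2 of the subgraphs with edge sets A, B. *)
Definition coupling A d1 B d2 x : int :=
  if x \in A :&: B then (if d1 x == d2 x then 1 else -1) else 0.

Definition is_tension (M : zmodType) e (f : {ffun E -> M}) : bool :=
  [forall C, forall d, is_circuit C ==> is_direction C d ==>
     (\sum_(x in C) f x *~ coupling [set: E] (arr e) C d x == 0)].

Definition nz_tensions (M : finZmodType) e : {set {ffun E -> M}} :=
  [set f | is_tension e f && [forall x, f x != 0]].

Definition proper_side S : bool := (S != set0) && (~: S != set0).

Definition cut S : {set E} :=
  [set x | (ends x :&: S != set0) && (ends x :&: ~: S != set0)].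

Definition is_cut B : bool := [exists S, proper_side S && (B == cut S)].

Definition is_directed_cut e B : bool :=
  [exists S, [&& proper_side S, B == cut S &
     [forall x in B, ((arr e x).1 \in S) && ((arr e x).2 \notin S)] ||
     [forall x in B, ((arr e x).1 \notin S) && ((arr e x).2 \in S)]]].

Definition is_directed_bond e B : bool :=
  minset (fun D => is_directed_cut e D && (D != set0)) B.

Definition is_oriented_cut e B : bool :=
  is_cut B &&
  [exists P : {set {set E}},
     partition P B && [forall D in P, is_directed_bond e D]].

Definition differ e r : {set E} := [set x | arr e x != arr r x].

Definition cut_equiv : rel orientation := fun e r =>
  [|| differ e r == set0, is_oriented_cut e (differ e r) |
      is_oriented_cut r (differ e r)].

Definition ac_classes : {set {set orientation}} :=
  equivalence_partition cut_equiv acyclics.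

Definition is_rep (rep : {set orientation} -> orientation) : Prop :=
  forall c : {set orientation}, c \in ac_classes -> rep c \in c.

End Graph.

From mathcomp Require Import finmap.
From mathcomp Require Import classical_sets cardinality reals.

Local Open Scope classical_set_scope.

(* The set is finite, so the default value of fset_set on infinite sets plays
   no role; likewise in lattice_points for a bounded P. *)
Definition tau_bar_count (G : mgraph)
    (rep : {set orientation G} -> orientation G) (q : nat) : nat :=
  #|` fset_set [set p : {set orientation G} * {ffun edge G -> int} |
        [/\ p.1 \in ac_classes G, is_tension (rep p.1) p.2 &
            forall x : edge G, 0 <= p.2 x <= q%:Z]] |%fset.

Section Polytopes.

Variables (R : realType) (G : mgraph).

Implicit Types e : orientation G.

Definition Delta_bar e : set {ffun edge G -> R} :=
  [set f | is_tension e f /\ forall x, 0 <= f x <= 1].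

Definition Delta e : set {ffun edge G -> R} :=
  [set f | is_tension e f /\ forall x, 0 < f x < 1].

Definition lattice_points (P : set {ffun edge G -> R}) (q : nat) : nat :=
  #|` fset_set ([set [ffun x => q%:R * f x] | f in P] `&`
                [set g : {ffun edge G -> R} | forall x, g x \is a Num.int])
  |%fset.

Definition is_ehrhart (P : set {ffun edge G -> R}) (p : {poly rat}) : Prop :=
  forall q : nat, (0 < q)%N -> p.[q%:R] = (lattice_points P q)%:R.

End Polytopes.

Arguments Delta_bar R {G} e _.
Arguments Delta R {G} e _.

(* Main.v *)
(* A tension is the coboundary of a potential V -> Z. Normalise the potential of an
   integral tension with values in [0, q] on one vertex per component, and divide it
   by q with remainder: p = q a + b. Then a has increments 0 or 1, so it encodes an
   orientation r cut-equivalent to e, and b : V -> {0, ..., q - 1} is weakly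
   increasing along r; it is strictly increasing iff the tension has values strictly
   between 0 and q. Hence q^k times the number of such tensions is a sum over the
   class of e of order polynomials, and the reciprocity law is Stanley's reciprocity
   for these. Strictly increasing maps for all acyclic orientations together are the
   proper colorings, of which there are q^k per nowhere-zero tension. For the value
   at 0, let b vanish on the chosen vertices: the order polynomial of r then has
   degree 0 for exactly one r in the class, the one in which every vertex has a
   directed path to a chosen vertex. *)
Require Import Defs.
From mathcomp Require Import all_boot all_order all_algebra.
From mathcomp Require Import reals.
From mathcomp Require Import ring zify.
Set Implicit Arguments.
Unset Strict Implicit.
Unset Printing Implicit Defensive.
Import Order.TTheory GRing.Theory Num.Theory.
Local Open Scope ring_scope.

(** * Order polynomials of a finite relation *)

(** Two normalisations of the maps b are in play, because neither suffices alone. With b = 0 on the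
    chosen vertices, the weak counts are order polynomials on vertex sets that shrink with r: their
    sum needs no division by q^k and can be read at 0, but reciprocity applied term by term gives
    signs that vary with the size of the set. With b free on all of V every sign is (-1)^|V|, but
    only q^k times the count appears. The proof equates the two as polynomials, X^k times the first
    being the second, and reflects this identity; X^k absorbs (-1)^k and leaves (-1)^r(G). The
    strict polynomial is therefore defined as the reflection of the weak one and only afterwards
    shown to count. Bonds are handled in one translation only: e and r are cut-equivalent iff the
    indicator of the edges they orient differently is the coboundary along e of an integer
    potential. *)

Lemma sum_sign_subsets (T : finType) (A : {set T}) :
  \sum_(B : {set T} | B \subset A) (-1) ^+ #|B| = (A == set0)%:R :> int.
Proof.
have [->|[a Aa]] := set_0Vmem A.
  rewrite eqxx (eq_bigl (pred1 set0)) ?big_pred1_eq ?cards0 //.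
  by move=> B; rewrite subset0.
have -> : (A == set0) = false by apply/negbTE/set0Pn; exists a.
(* Toggling [a] pairs the subsets with opposite signs. *)
rewrite (bigID (fun B : {set T} => a \in B)) /=.
rewrite (reindex_onto (fun B => a |: B) (fun B => B :\ a)) /=; last first.
  by move=> B /andP[_ aB]; rewrite setD1K.
rewrite [X in _ + X](eq_bigl (fun B : {set T} => (a |: B \subset A) &&
    (a \in a |: B) && ((a |: B) :\ a == B))); last first.
  move=> B; rewrite setU11 subUset sub1set Aa /= andbT; congr (_ && _).
  apply/idP/eqP => [aB|<-]; last by rewrite !inE eqxx.
  by rewrite setU1K.
rewrite -big_split /= big1 // => B /andP[_ /eqP <-].
by rewrite setD1K ?setU11 // (cardsD1 a (_ |: _)) setU11 exprS mulN1r addNr.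
Qed.

(* A map on J with values below q is encoded by a function vanishing off J; in
   this way the bound N plays no role as long as q <= N.+1. *)
Section OrderMaps.

Variables (T : finType) (D : rel T) (N : nat).
Implicit Types (s : bool) (J K : {set T}) (b : {ffun T -> 'I_N.+1}).

(** The boolean [s] is added as 0 or 1, so one inequality serves the weak and the strict case. *)
Definition order_maps (s : bool) (q : nat) J : {set {ffun T -> 'I_N.+1}} :=
  [set b : {ffun T -> 'I_N.+1} | [forall v, if v \in J then b v < q else b v == 0 :> nat]%N &&
     [forall u in J, forall v in J, D u v ==> (s + b u <= b v)%N]].

Lemma order_mapsP s q J b :
  reflect [/\ forall v, v \in J -> (b v < q)%N, forall v, v \notin J -> b v = ord0
            & forall u v, u \in J -> v \in J -> D u v -> (s + b u <= b v)%N]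
          (b \in order_maps s q J).
Proof.
rewrite inE; apply: (iffP andP) => [[/forallP bJ /forall_inP mb]|[bJ b0 mb]]; split.
- by move=> v vJ; have := bJ v; rewrite vJ.
- by move=> v vJ; have := bJ v; rewrite (negPf vJ) => /eqP b0; apply: val_inj.
- by move=> u v uJ vJ Duv; apply: (implyP (forall_inP (mb u uJ) v vJ)).
- apply/forallP => v; case: ifPn => [/bJ//|/b0 ->//].
- by apply/forall_inP => u uJ; apply/forall_inP => v vJ; apply/implyP/mb.
Qed.

Definition sinks J := [set v in J | [forall w in J, ~~ D v w]].

Definition overwrite K (a : 'I_N.+1) b := [ffun v => if v \in K then a else b v].

Lemma card_order_maps0 s J : #|order_maps s 0 J| = (J == set0).
Proof.
have [->|[a aJ]] := set_0Vmem J.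
  rewrite eqxx -[RHS](cards1 ([ffun=> ord0] : {ffun T -> 'I_N.+1})).
  apply: eq_card => b; rewrite in_set1; apply/order_mapsP/eqP => [[_ b0 _]|->].
    by apply/ffunP => v; rewrite ffunE b0 ?inE.
  by split=> [v|v _|u v]; rewrite ?inE ?ffunE.
have -> : (J == set0) = false by apply/negbTE/set0Pn; exists a.
apply: eq_card0 => b; apply/negP => /order_mapsP[bJ _ _].
by have := bJ a aJ.
Qed.

Definition top q J b := [set v in J | b v == q :> nat].

Lemma sinksP J v : reflect (v \in J /\ forall w, w \in J -> ~~ D v w) (v \in sinks J).
Proof.
rewrite inE; apply: (iffP andP) => -[vJ H]; split=> //.
  exact/forall_inP.
exact/forall_inP.
Qed.

Lemma sinks_sub J : sinks J \subset J.
Proof. by apply/subsetP => v /sinksP[]. Qed.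

Lemma order_maps_top_sinks q J b : b \in order_maps true q.+1 J -> top q J b \subset sinks J.
Proof.
case/order_mapsP => bJ _ mb; apply/subsetP => v; rewrite inE => /andP[vJ /eqP bv].
apply/sinksP; split=> // w wJ; apply/negP => Dvw.
by have := mb v w vJ wJ Dvw; have := bJ w wJ; lia.
Qed.

(** A strict map that takes the largest value [q] exactly on [K] is determined by its restriction to
    the rest, which stays below [q]. Conversely [q] may be put on any set of sinks, since no arrow
    leaves them inside [J]. *)
Lemma card_strict_top q J K : (q <= N)%N -> K \subset sinks J ->
  #|[set b in order_maps true q.+1 J | top q J b == K]| =
  #|order_maps true q (J :\: K)|.
Proof.
move=> qN sKM; have sKJ := subset_trans sKM (sinks_sub J).
have ordq : @inord N q = q :> nat by rewrite inordK.
rewrite -(card_in_imset (f := overwrite K (@inord N q)) (D := order_maps true q (J :\: K))).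
  apply: eq_card => b; rewrite inE; apply/andP/imsetP => [[bO /eqP tb]|[c cO ->]].
    have [bJ b0 mb] := order_mapsP _ _ _ _ bO.
    exists (overwrite K ord0 b).
      apply/order_mapsP; split=> [v|v|u v].
      - rewrite inE ffunE => /andP[vK vJ]; rewrite (negPf vK).
        have := bJ v vJ; rewrite ltnS leq_eqVlt => /predU1P[bq|//].
        by case/negP: vK; rewrite -tb inE vJ bq eqxx.
      - by rewrite inE negb_and negbK ffunE; case: ifP => //= _ /b0.
      - rewrite !inE !ffunE => /andP[/negPf-> uJ] /andP[/negPf-> vJ]; exact: mb.
    apply/ffunP => v; rewrite !ffunE; case: ifP => vK; rewrite ?vK //.
    apply: val_inj; rewrite /= ordq; move: vK; rewrite -tb inE.
    by case/andP=> _ /eqP.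
  have [cJ c0 mc] := order_mapsP _ _ _ _ cO.
  have cK v : v \in J -> v \notin K -> (c v < q)%N.
    by move=> vJ vK; apply: cJ; rewrite inE vJ vK.
  split.
    apply/order_mapsP; split=> [v vJ|v vJ|u v uJ vJ Duv]; rewrite !ffunE.
    - by case: ifPn => [_|/(cK v vJ)/ltnW//]; rewrite ordq.
    - rewrite ifN ?c0 ?inE ?(negPf vJ) ?andbF //.
      by apply: contra vJ; apply: (subsetP sKJ).
    - case: ifPn => uK.
        by have /sinksP[_ /(_ v vJ)] := subsetP sKM u uK; rewrite Duv.
      case: ifPn => vK; last by apply: mc; rewrite ?inE ?uK ?vK.
      by rewrite ordq; have := cK u uJ uK.
  apply/eqP/setP => v; rewrite inE ffunE; case: ifPn => vK.
    by rewrite (subsetP sKJ) // ordq eqxx.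
  by case: (boolP (v \in J)) => //= vJ; apply/negbTE; rewrite neq_ltn cK.
move=> c1 c2 /order_mapsP[_ c10 _] /order_mapsP[_ c20 _] /ffunP ec.
apply/ffunP => v; case: (boolP (v \in K)) => vK.
  by rewrite c10 ?c20 // inE vK.
by have := ec v; rewrite !ffunE (negPf vK).
Qed.

Lemma card_order_maps_strictS q J : (q <= N)%N ->
  #|order_maps true q.+1 J| =
  (\sum_(K : {set T} | K \subset sinks J) #|order_maps true q (J :\: K)|)%N.
Proof.
move=> qN; rewrite -sum1_card.
rewrite (partition_big (top q J) (fun K => K \subset sinks J)) /=; last first.
  exact: order_maps_top_sinks.
apply: eq_bigr => K sK; rewrite -(card_strict_top qN sK) -sum1_card.
by apply: eq_bigl => b; rewrite inE.
Qed.

(** Putting [q] on a set of sinks also keeps a weak map weak. Here [K] need only lie inside the top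
    set, so the rest may still take the value [q] and the bound does not drop. *)
Lemma card_weak_top q J K : (q <= N)%N -> K \subset sinks J ->
  #|[set b in order_maps false q.+1 J | K \subset top q J b]| =
  #|order_maps false q.+1 (J :\: K)|.
Proof.
move=> qN sKM; have sKJ := subset_trans sKM (sinks_sub J).
have ordq : @inord N q = q :> nat by rewrite inordK.
rewrite -(card_in_imset (f := overwrite K (@inord N q)) (D := order_maps false q.+1 (J :\: K))).
  apply: eq_card => b; rewrite inE; apply/andP/imsetP => [[bO tb]|[c cO ->]].
    have [bJ b0 mb] := order_mapsP _ _ _ _ bO.
    exists (overwrite K ord0 b).
      apply/order_mapsP; split=> [v|v|u v].
      - by rewrite inE ffunE => /andP[vK vJ]; rewrite (negPf vK) bJ.
      - by rewrite inE negb_and negbK ffunE; case: ifP => //= _ /b0.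
      - rewrite !inE !ffunE => /andP[/negPf-> uJ] /andP[/negPf-> vJ]; exact: mb.
    apply/ffunP => v; rewrite !ffunE; case: ifP => vK; rewrite ?vK //.
    apply: val_inj; rewrite /= ordq.
    by have := subsetP tb v vK; rewrite inE => /andP[_ /eqP].
  have [cJ c0 mc] := order_mapsP _ _ _ _ cO.
  have cK v : v \in J -> v \notin K -> (c v < q.+1)%N.
    by move=> vJ vK; apply: cJ; rewrite inE vJ vK.
  split.
    apply/order_mapsP; split=> [v vJ|v vJ|u v uJ vJ Duv]; rewrite !ffunE.
    - by case: ifPn => [_|/(cK v vJ)//]; rewrite ordq.
    - rewrite ifN ?c0 ?inE ?(negPf vJ) ?andbF //.
      by apply: contra vJ; apply: (subsetP sKJ).
    - case: ifPn => uK.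
        by have /sinksP[_ /(_ v vJ)] := subsetP sKM u uK; rewrite Duv.
      case: ifPn => vK; last by apply: mc; rewrite ?inE ?uK ?vK.
      by rewrite ordq; have := cK u uJ uK.
  apply/subsetP => v vK; rewrite inE ffunE vK ordq eqxx andbT.
  exact: (subsetP sKJ).
move=> c1 c2 /order_mapsP[_ c10 _] /order_mapsP[_ c20 _] /ffunP ec.
apply/ffunP => v; case: (boolP (v \in K)) => vK.
  by rewrite c10 ?c20 // inE vK.
by have := ec v; rewrite !ffunE (negPf vK).
Qed.

Hypothesis acyclicD : exists h : T -> nat, forall u v, D u v -> (h u < h v)%N.

(* If q is attained on J, then it is attained at a sink of J. *)
Lemma order_maps_top_set0 q J b :
  b \in order_maps false q.+1 J ->
  (sinks J :&: top q J b == set0) = (b \in order_maps false q J).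
Proof.
move=> bO; have [bJ b0 mb] := order_mapsP _ _ _ _ bO.
apply/eqP/order_mapsP => [e0|[bq _ _]]; last first.
  apply/setP => v; rewrite !inE; apply/negP => /and3P[_ vJ /eqP bv].
  by have := bq v vJ; rewrite bv ltnn.
split=> // v vJ; rewrite ltn_neqAle -ltnS bJ // andbT; apply/negP => /eqP bv.
have [h hD] := acyclicD.
have vt : v \in top q J b by rewrite inE vJ bv eqxx.
have [w wt wmax] : exists2 w, w \in top q J b & forall x, x \in top q J b -> (h x <= h w)%N.
  by case: (arg_maxnP h vt) => w wt wmax; exists w.
have := in_set0 w; rewrite -e0 inE wt andbT => /negP; apply.
move: wt; rewrite inE => /andP[wJ /eqP bw].
apply/sinksP; split=> // x xJ; apply/negP => Dwx.
have /wmax : x \in top q J b.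
  have := mb w x wJ xJ Dwx; have := bJ x xJ.
  by rewrite inE xJ bw /= add0n ltnS eqn_leq => -> ->.
by rewrite leqNgt hD.
Qed.

(** Inclusion-exclusion over the sinks that carry the value [q]: a weak map stays below [q] iff no
    sink carries it. *)
Lemma card_order_maps_weak q J : (q <= N)%N ->
  #|order_maps false q J|%:R =
  \sum_(K : {set T} | K \subset sinks J)
     (-1) ^+ #|K| * #|order_maps false q.+1 (J :\: K)|%:R :> int.
Proof.
move=> qN.
transitivity (\sum_(b in order_maps false q.+1 J)
    (sinks J :&: top q J b == set0)%:R : int).
  rewrite -natr_sum -sum1_card; congr (_%:R).
  rewrite [RHS](eq_bigr (fun b => (b \in order_maps false q J) : nat)); last first.
    by move=> b bO; rewrite (order_maps_top_set0 bO).
  rewrite -big_mkcondr /= sum1_card -sum1_card; apply: eq_bigl => b.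
  rewrite andbC; case: (boolP (b \in order_maps false q J)) => //=.
  case/order_mapsP => bJ b0 mb; symmetry; apply/order_mapsP; split=> //.
  by move=> v /bJ /ltnW.
under eq_bigr => b _ do rewrite -sum_sign_subsets.
rewrite (exchange_big_dep (fun K => K \subset sinks J)) /=; last first.
  by move=> b K _; rewrite subsetI => /andP[].
apply: eq_bigr => K sK; rewrite -(card_weak_top qN sK) sumr_const mulr_natr.
congr (_ *+ _); apply: eq_card => b; by rewrite [RHS]in_set [LHS]unfold_in /= subsetI sK.
Qed.

End OrderMaps.

(** Induction on the size: the difference of a multiple of ['X^(n.+1)] has the top coefficient of
    [p], and what remains is smaller. *)
Lemma poly_antidifference (p : {poly rat}) :
  exists s : {poly rat},
    [/\ (size s <= (size p).+1)%N, s.[0] = 0 & forall x, s.[x + 1] = s.[x] + p.[x]].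
Proof.
suff: forall n, (size p <= n)%N -> exists s : {poly rat},
    [/\ (size s <= n.+1)%N, s.[0] = 0 & forall x, s.[x + 1] = s.[x] + p.[x]].
  by apply.
move=> n; elim: n p => [|n IHn] p.
  rewrite leqn0 size_poly_eq0 => /eqP->; exists 0.
  by split=> [||x]; rewrite ?size_poly0 ?horner0 ?addr0.
move=> sp.
(* [l] gathers the terms of degree below [n] in (x + 1)^(n + 1) - x^(n + 1), and [a] matches the
   coefficient of degree [n] of [p]. *)
pose l : {poly rat} := \sum_(i < n) ('C(n.+1, i)%:R *: 'X^i).
pose a := p`_n / n.+1%:R.
have n1 : n.+1%:R != 0 :> rat by rewrite pnatr_eq0.
have sl : (size l <= n)%N.
  apply: (leq_trans (size_sum _ _ _)); apply/bigmax_leqP => i _.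
  by rewrite (leq_trans (size_scale_leq _ _)) // size_polyXn.
have diffX x : (x + 1) ^+ n.+1 = x ^+ n.+1 + (n.+1%:R * x ^+ n + l.[x]).
  rewrite exprD1n !big_ord_recr /= binn binSn horner_sum addrC mulr1n; congr (_ + _).
  rewrite addrC mulr_natl; congr (_ + _); apply: eq_bigr => i _.
  by rewrite hornerZ hornerXn mulr_natl.
have sr : (size (p - a *: (n.+1%:R *: 'X^n + l))%R <= n)%N.
  apply/leq_sizeP => j; rewrite leq_eqVlt => /predU1P[<-|ltnj].
    rewrite coefB coefZ coefD coefZ coefXn eqxx mulr1 [l`_n]nth_default // addr0.
    by rewrite /a divfK // subrr.
  rewrite coefB coefZ coefD coefZ coefXn (gtn_eqF ltnj) [p`_j]nth_default; last first.
    exact: leq_trans ltnj.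
  by rewrite [l`_j]nth_default ?(leq_trans sl) ?(ltnW ltnj) // mulr0 addr0 mulr0 subr0.
have [s [ss s0 sx]] := IHn _ sr.
exists (s + a *: 'X^(n.+1))%R; split=> [||x].
- rewrite (leq_trans (size_polyD _ _)) // geq_max (leq_trans ss) //=.
  by rewrite (leq_trans (size_scale_leq _ _)) // size_polyXn.
- by rewrite hornerD s0 hornerZ hornerXn expr0n mulr0 addr0.
- by rewrite !hornerE sx !hornerE diffX /=; ring.
Qed.

(** * Order polynomials and Stanley's reciprocity *)

Section OrderPolynomials.

Variables (T : finType) (D : rel T).
Implicit Types (J K : {set T}).

(** With the term [K = set0] moved to the left, the recursion prescribes the difference of [P J]
    through smaller sets, so an antidifference solves it. It holds at every rational [x], hence can
    be read at negative arguments. *)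
Lemma order_polynomials_exist : exists P : {set T} -> {poly rat}, forall J,
  [/\ (size (P J) <= #|J|.+1)%N, (P J).[0] = (J == set0)%:R
    & forall x, (P J).[x + 1] = \sum_(K : {set T} | K \subset sinks D J) (P (J :\: K)).[x]].
Proof.
suff H n : exists P : {set T} -> {poly rat}, forall J, (#|J| <= n)%N ->
  [/\ (size (P J) <= #|J|.+1)%N, (P J).[0] = (J == set0)%:R
    & forall x, (P J).[x + 1] = \sum_(K : {set T} | K \subset sinks D J) (P (J :\: K)).[x]].
  by have [P HP] := H #|T|; exists P => J; apply/HP/max_card.
have sDJ J K : K \subset sinks D J -> K != set0 -> (#|J :\: K| < #|J|)%N.
  move=> sK K0; have sKJ := subset_trans sK (sinks_sub D J).
  have K1 : (0 < #|K|)%N by rewrite card_gt0.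
  by rewrite cardsDS // ltn_subrL K1 (leq_trans K1) // subset_leq_card.
elim: n => [|n [P HP]].
  exists (fun=> 1) => J; rewrite leqn0 cards_eq0 => /eqP->.
  rewrite size_poly1 hornerC eqxx; split=> // x.
  have -> : sinks D set0 = set0 by apply/eqP; rewrite -subset0 sinks_sub.
  rewrite (eq_bigl (pred1 set0)) ?big_pred1_eq ?hornerC // => K.
  exact: subset0.
have HQ J : exists s : {poly rat}, (#|J| = n.+1)%N ->
    [/\ (size s <= #|J|.+1)%N, s.[0] = 0
    & forall x, s.[x + 1] = s.[x] +
       \sum_(K : {set T} | (K \subset sinks D J) && (K != set0)) (P (J :\: K)).[x]].
  have [s [ss s0 sx]] := poly_antidifference
    (\sum_(K : {set T} | (K \subset sinks D J) && (K != set0)) P (J :\: K)).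
  exists s => cJ; split=> // [|x]; last by rewrite sx horner_sum.
  rewrite (leq_trans ss) // ltnS (leq_trans (size_sum _ _ _)) //.
  apply/bigmax_leqP => K /andP[sK K0].
  have ltJK := sDJ J K sK K0.
  have leJK : (#|J :\: K| <= n)%N by rewrite -ltnS -cJ.
  by have [sP _ _] := HP _ leJK; apply: leq_trans sP _.
have [Q HQ'] := fin_all_exists HQ.
exists (fun J => if (#|J| <= n)%N then P J else Q J) => J leJ.
have E J' : (#|J'| <= n)%N -> (if (#|J'| <= n)%N then P J' else Q J') = P J'.
  by move=> ->.
case: ifPn => [leJn|]; first have [sP P0 Px] := HP J leJn.
  split=> // x; rewrite Px; apply: eq_bigr => K sK; rewrite E //.
  exact: leq_trans (subset_leq_card (subsetDl _ _)) leJn.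
rewrite -ltnNge => ltnJ; have cJ : #|J| = n.+1 by apply/eqP; rewrite eqn_leq leJ.
have [sQ Q0 Qx] := HQ' J cJ.
have J0 : (J == set0) = false by rewrite -cards_eq0 cJ.
split=> // [|x]; first by rewrite Q0 J0.
rewrite Qx [RHS](bigD1 set0) ?sub0set //= setD0 ifN -?ltnNge //; congr (_ + _).
apply: eq_bigr => K /andP[sK K0]; rewrite E //.
by rewrite -ltnS -cJ sDJ.
Qed.

Hypothesis acyclicD : exists h : T -> nat, forall u v, D u v -> (h u < h v)%N.

(* Stanley's reciprocity: the recursion card_order_maps_strictS of the strict
   counts, read at -q, is the recursion card_order_maps_weak of the weak ones. *)
Lemma order_polynomial_reciprocity : exists P U : {set T} -> {poly rat}, forall J,
  [/\ (size (P J) <= #|J|.+1)%N, U J = (-1) ^+ #|J| *: (P J \Po - 'X),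
      (U J).[0] = (J == set0)%:R &
      forall N q, (q <= N.+1)%N ->
        (P J).[q%:R] = #|order_maps D N true q J|%:R /\
        (U J).[q%:R] = #|order_maps D N false q J|%:R].
Proof.
have [P HP] := order_polynomials_exist.
pose U J := (-1) ^+ #|J| *: (P J \Po - 'X); exists P, U => J.
have Ux K x : (U K).[x] = (-1) ^+ #|K| * (P K).[- x].
  by rewrite /U hornerZ horner_comp !hornerE.
have U0 K : (U K).[0] = (K == set0)%:R.
  have [_ P0 _] := HP K; rewrite Ux oppr0 P0.
  by case: eqP => [->|_]; rewrite ?cards0 ?mulr0 ?mul1r.
have [sP _ _] := HP J; split=> // N q leqN; split.
  elim: q J leqN {sP} => [|q IHq] J leqN; have [_ P0 Px] := HP J.
    by rewrite P0 card_order_maps0.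
  rewrite -natr1 Px card_order_maps_strictS // natr_sum.
  by apply: eq_bigr => K _; apply/IHq/ltnW.
(* This is the recursion of [P] at [- x - 1]; the sign of [K] splits into those of [L] and of
   [K :\: L]. *)
have USx K x : (U K).[x] =
    \sum_(L : {set T} | L \subset sinks D K) (-1) ^+ #|L| * (U (K :\: L)).[x + 1].
  have [_ _ Px] := HP K; rewrite Ux -[- x](subrK 1) Px mulr_sumr.
  apply: eq_bigr => L sL; rewrite Ux mulrA -exprD opprD; congr (_ * _).
  have sLK := subset_trans sL (sinks_sub D K).
  by rewrite cardsDS // subnKC // subset_leq_card.
elim: q J leqN {sP} => [|q IHq] J leqN; first by rewrite U0 card_order_maps0.
have eqS K : \sum_(L : {set T} | L \subset sinks D K) (-1) ^+ #|L| * (U (K :\: L)).[q.+1%:R] =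
    \sum_(L : {set T} | L \subset sinks D K)
       (-1) ^+ #|L| * #|order_maps D N false q.+1 (K :\: L)|%:R.
  have := card_order_maps_weak acyclicD K (leqN : (q <= N)%N) => /(congr1 (intr : int -> rat)).
  rewrite rmorph_sum /= rmorph_nat -IHq ?(ltnW leqN) // USx natr1 => ->.
  by apply: eq_bigr => L _; rewrite rmorphM rmorph_sign rmorph_nat.
(* The weak recursion expresses values at [q] by values at [q.+1]. The term with [L = set0] is the
   unknown one; all others belong to smaller sets. *)
have [m] := ubnP #|J|; elim: m J => // m IHm J leJ.
have := eqS J; rewrite (bigD1 set0) ?sub0set //= [RHS](bigD1 set0) ?sub0set //=.
rewrite cards0 expr0 !mul1r setD0; set s1 := \sum_(i | _) _; set s2 := \sum_(i | _) _.
suff -> : s1 = s2 by apply: addIr.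
apply: eq_bigr => L /andP[sL L0]; rewrite IHm //.
have sLJ := subset_trans sL (sinks_sub D J).
have L1 : (0 < #|L|)%N by rewrite card_gt0.
apply: leq_trans (leJ : (_ <= m)%N).
by rewrite cardsDS // ltn_subrL L1 (leq_trans L1) // subset_leq_card.
Qed.

End OrderPolynomials.

(** * Circuits, tensions and potentials *)

Section GraphBasics.

Variable G : mgraph.
Hypothesis loopless_G : loopless G.

Local Notation V := (vert G).
Local Notation E := (edge G).

Implicit Types (C : {set E}) (S : {set V}) (u v w : V) (x y : E).
Implicit Types (d : arrows G) (e r : orientation G).

Definition tl e x := (arr e x).1.
Definition hd e x := (arr e x).2.
Definition swap (T : Type) (a : T * T) := (a.2, a.1).

Lemma arr_ends e x : [set tl e x; hd e x] = ends x.
Proof. by have /forall_inP/(_ x (in_setT x))/eqP := valP e. Qed.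

Lemma set2_eq (T : finType) (a b c d : T) :
  [set a; b] = [set c; d] -> (a = c /\ b = d) \/ (a = d /\ b = c).
Proof.
move=> eq2.
have : a \in [set c; d] by rewrite -eq2 set21.
have : b \in [set c; d] by rewrite -eq2 set22.
have : c \in [set a; b] by rewrite eq2 set21.
have : d \in [set a; b] by rewrite eq2 set22.
by rewrite !inE; do 4![case/orP => /eqP ?]; subst; auto.
Qed.

Lemma tl_neq_hd e x : tl e x != hd e x.
Proof. by have := loopless_G x; rewrite -(arr_ends e) cards2; case: eqP. Qed.

Lemma orients_arr C d e x : orients C d -> x \in C -> d x = arr e x \/ d x = swap (arr e x).
Proof.
move=> /forall_inP dC /dC /eqP; rewrite -(arr_ends e) => /set2_eq.
rewrite /tl /hd /swap; case: (d x) => a b /=.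
by case=> -[-> ->]; [left; case: (arr e x)|right].
Qed.

Lemma arr_cases e r x : arr r x = arr e x \/ arr r x = swap (arr e x).
Proof. exact: orients_arr (valP r) (in_setT x). Qed.

Lemma arr_neq_swap e x : arr e x != swap (arr e x).
Proof.
by have := tl_neq_hd e x; rewrite /tl /hd /swap; case: (arr e x) => a b; apply: contra => /eqP[->].
Qed.

(** Each vertex of [C] is the head of exactly one edge and the tail of exactly one, so [p] cancels
    vertex by vertex. *)
Lemma direction_sum_eq0 (M : zmodType) C d (p : V -> M) :
  is_direction C d -> \sum_(x in C) (p (d x).2 - p (d x).1) = 0.
Proof.
case/andP=> oC /forallP dC.
have out v : ~~ incident C v -> forall x, x \in C -> ((d x).2 != v) && ((d x).1 != v).
  move=> nv x xC; have /forall_inP/(_ x xC)/eqP ex := oC.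
  apply/andP; split; apply: contra nv => /eqP <-;
    by apply/existsP; exists x; rewrite xC -ex !inE eqxx ?orbT.
rewrite sumrB (partition_big (fun x => (d x).2) predT) //=.
rewrite [X in _ - X](partition_big (fun x => (d x).1) predT) //= -sumrB.
apply: big1 => v _.
rewrite (eq_bigr (fun=> p v)) => [|x /andP[_ /eqP->]//].
rewrite [X in _ - X](eq_bigr (fun=> p v)) => [|x /andP[_ /eqP->]//].
rewrite !sumr_const; case: (boolP (incident C v)) => iv.
  have := dC v; rewrite iv !cardsE => /andP[/eqP c1 /eqP c2].
  by rewrite [X in _ *+ X - _]c1 [X in _ - _ *+ X]c2 subrr.
rewrite !eq_card0 ?subrr // => x; rewrite !inE unfold_in; apply/negP => /andP[xC];
  by case/andP: (out v iv x xC) => /negPf h1 /negPf h2; rewrite ?h1 ?h2.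
Qed.

Definition dpot (M : zmodType) e (p : V -> M) x := p (hd e x) - p (tl e x).

Lemma dpotB (M : zmodType) e (p p' : V -> M) x :
  dpot e (fun v => p v - p' v) x = dpot e p x - dpot e p' x.
Proof. by rewrite /dpot !opprD !opprK addrACA. Qed.

Lemma dpot_coupling (M : zmodType) e (p : V -> M) C d x :
  orients C d -> x \in C ->
  dpot e p x *~ coupling [set: E] (arr e) C d x = p (d x).2 - p (d x).1.
Proof.
move=> oC xC; rewrite /coupling !inE xC /dpot /hd /tl.
have [->|->] := orients_arr e oC xC; first by rewrite eqxx.
by rewrite (negPf (arr_neq_swap e x)) /= mulrN1z opprB.
Qed.

Lemma dpot_tension (M : zmodType) e (p : V -> M) (f : {ffun E -> M}) :
  (forall x, f x = dpot e p x) -> is_tension e f.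
Proof.
move=> fp; apply/forallP => C; apply/forallP => d.
apply/implyP => _; apply/implyP => dC; apply/eqP.
rewrite -[RHS](direction_sum_eq0 p dC); apply: eq_bigr => x xC.
by rewrite fp dpot_coupling //; case/andP: dC.
Qed.

Lemma cycle_circuit (s : seq V) (ed : V -> E) d :
  uniq s -> s != [::] ->
  {in s, forall a, ends (ed a) = [set a; next s a]} ->
  {in s, forall a, d (ed a) = (a, next s a)} ->
  let C := [set ed a | a in s] in is_circuit C /\ is_direction C d.
Proof.
move=> us s0 eds ded C.
have edC a : a \in s -> ed a \in C by move=> sa; apply: imset_f.
have inc v : incident C v = (v \in s).
  apply/existsP/idP => [[x /andP[/imsetP[a sa ->]]]|sv].
    by rewrite eds // !inE => /orP[]/eqP-> //; rewrite mem_next.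
  by exists (ed v); rewrite edC // eds // set21.
have eds2 v : v \in s -> ends (ed (prev s v)) = [set prev s v; v].
  by move=> sv; rewrite eds ?mem_prev // next_prev.
have ded2 v : v \in s -> d (ed (prev s v)) = (prev s v, v).
  by move=> sv; rewrite ded ?mem_prev // next_prev.
have tlC v : v \in s -> [set x in C | (d x).1 == v] = [set ed v].
  move=> sv; apply/setP => x; rewrite !inE; apply/andP/eqP => [[/imsetP[a sa ->]]|->].
    by rewrite ded //= => /eqP->.
  by rewrite edC // ded.
have hdC v : v \in s -> [set x in C | (d x).2 == v] = [set ed (prev s v)].
  move=> sv; apply/setP => x; rewrite !inE; apply/andP/eqP => [[/imsetP[a sa ->]]|->].
    by rewrite ded //= => /eqP <-; rewrite prev_next.
  by rewrite edC ?mem_prev // ded2.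
split; last first.
  apply/andP; split.
    by apply/forall_inP => x /imsetP[a sa ->]; rewrite ded //= eds.
  by apply/forallP => v; apply/implyP; rewrite inc => sv; rewrite tlC ?hdC // !cards1.
apply/and3P; split.
- by case: s s0 {us eds ded inc eds2 ded2 tlC hdC} @C edC => // a s _ C edC;
    apply/set0Pn; exists (ed a); rewrite edC // mem_head.
- apply/forallP => v; apply/implyP; rewrite inc => sv; apply/eqP.
  rewrite /degree (eq_bigr (fun=> 1%N)) => [|x _]; last by rewrite loopless_G.
  rewrite sum1dep_card.
  have -> : [set x | (x \in C) && (v \in ends x)] = [set ed v; ed (prev s v)].
    apply/setP => x; rewrite !inE; apply/andP/orP => [[/imsetP[a sa ->]]|[]/eqP->].
    - rewrite eds // !inE => /orP[]/eqP->; first by left.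
      by right; rewrite prev_next.
    - by rewrite edC // eds // set21.
    - by rewrite edC ?mem_prev // eds2 // set22.
  (* If the two edges at [v] coincided, their common arrow under [d] would make [v] its own
     predecessor and the edge a loop. This also rules out a sequence of length 1 and a single edge
     used back and forth. *)
  rewrite cards2; case: eqP => // evp; have := ded2 v sv; rewrite -evp ded // => -[vp _].
  by have := loopless_G (ed (prev s v)); rewrite eds2 // -vp setUid cards1.
- apply/forallP => u; apply/forallP => v; apply/implyP => iu; apply/implyP => iv.
  apply: (@connect_cycle _ _ s); rewrite -?inc //.
  apply: cycle_from_next => // a sa; apply/existsP; exists (ed a).
  by rewrite edC // eds //=.
Qed.

Lemma adj_sym C : symmetric (adj C).
Proof. by move=> u v; apply: eq_existsb => x; rewrite setUC. Qed.

Lemma connect_adj_sym C : connect_sym (adj C).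
Proof. exact: sym_connect_sym (adj_sym C). Qed.

Lemma adj_arr C e x : x \in C -> adj C (tl e x) (hd e x).
Proof. by move=> xC; apply/existsP; exists x; rewrite xC arr_ends eqxx. Qed.

Lemma index_next_path u p a : uniq (u :: p) -> a \in u :: p -> a != last u p ->
  index (next (u :: p) a) (u :: p) = (index a (u :: p)).+1.
Proof.
move=> up ap al; rewrite next_nth ap.
have lt_ap : (index a (u :: p) < size p)%N.
  have := ap; rewrite -index_mem ltnS leq_eqVlt => /predU1P[ea|//].
  case/eqP: al; rewrite -(nth_index u ap) ea -last_nth //.
rewrite -[nth u p _]/(nth u (u :: p) (index a (u :: p)).+1) index_uniq //.
Qed.

(** A path without repetition in [C] from the head of [x] back to its tail is closed up by [x]. *)
Lemma path_circuit C e x : x \notin C -> connect (adj C) (hd e x) (tl e x) ->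
  exists D d, [/\ is_circuit D, is_direction D d, x \in D, D \subset x |: C & d x = arr e x].
Proof.
move=> xC /connectP[p0 p0P]; case/shortenP: p0P => p pP up _ lastp {p0}.
set u := hd e x in pP up lastp; set v := tl e x in lastp; set s := u :: p in up.
have nextv : next s v = u.
  rewrite next_nth lastp mem_last /s -/s index_last //.
  by rewrite nth_default.
have vs : v \in s by rewrite lastp mem_last.
pose nx := [rel a b | adj C a b || (a == v) && (b == u)].
have cs : cycle nx s.
  rewrite /s /cycle rcons_path -lastp /= !eqxx orbT andbT.
  by apply: sub_path pP => a b /=->.
have adjn a : a \in s -> a != v -> adj C a (next s a).
  by move=> sa av; have := next_cycle cs sa; rewrite /= (negPf av) orbF.
pose ed a := if a == v then x else odflt x [pick y in C | ends y == [set a; next s a]].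
have edP a : a \in s -> a != v -> ed a \in C /\ ends (ed a) = [set a; next s a].
  move=> sa av; rewrite /ed (negPf av); case: pickP => [y /andP[yC /eqP]//|no].
  by have /existsP[y] := adjn a sa av; rewrite -setUC setUC => yP; have := no y; rewrite yP.
(* Edges of the path point towards increasing position on [s]; [x] runs from the last vertex to the
   first. *)
pose d : arrows G := [ffun y => if y == x then (v, u) else
  if (index (tl e y) s < index (hd e y) s)%N then arr e y else swap (arr e y)].
exists [set ed a | a in s], d.
have eds : {in s, forall a, ends (ed a) = [set a; next s a]}.
  move=> a sa; case: (eqVneq a v) => [->|av]; last by case: (edP a sa av).
  by rewrite /ed eqxx nextv -(arr_ends e).
have ded : {in s, forall a, d (ed a) = (a, next s a)}.
  move=> a sa; rewrite ffunE; case: (eqVneq a v) => [->|av].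
    by rewrite /ed !eqxx nextv.
  have [eC ee] := edP a sa av.
  have -> : (ed a == x) = false by apply: contraNF xC => /eqP <-.
  have ia : index (next s a) s = (index a s).+1 by apply: index_next_path; rewrite -?lastp.
  rewrite -(arr_ends e) in ee; rewrite /swap.
  rewrite [arr e _]surjective_pairing -/(tl _ _) -/(hd _ _).
  by case/set2_eq: ee => -[-> ->]; rewrite ia ?ltnSn // ltnNge leqnSn.
have [cC dC] := cycle_circuit up isT eds ded.
split=> //.
- by apply/imsetP; exists v; rewrite /ed ?eqxx.
- apply/subsetP => y /imsetP[a sa ->]; rewrite !inE.
  by case: (eqVneq a v) => [->|av]; [rewrite /ed !eqxx|case: (edP a sa av) => ->; rewrite orbT].
- by rewrite ffunE eqxx; rewrite /u /v /hd /tl; case: (arr e x).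
Qed.

(** Edges are treated one at a time. If the ends of [x] are already connected, a circuit through [x]
    forces its value; otherwise adding the defect [c] on the component of its head corrects [x]
    without disturbing earlier edges. *)
Lemma tension_dpot (M : zmodType) e (f : {ffun E -> M}) :
  is_tension e f -> exists p : V -> M, forall x, f x = dpot e p x.
Proof.
move=> tf; suff H (s : seq E) : exists p : V -> M, {in s, forall x, f x = dpot e p x}.
  by have [p Hp] := H (enum E); exists p => x; apply: Hp; rewrite mem_enum.
elim: s => [|x s [p IHp]]; first by exists (fun=> 0).
have [xs|xs] := boolP (x \in s).
  by exists p => y; rewrite inE => /predU1P[->|]; apply: IHp.
set A := [set y in s]; have xA : x \notin A by rewrite inE.
have [cx|ncx] := boolP (connect (adj A) (hd e x) (tl e x)).
  exists p => y; rewrite inE => /predU1P[->{y}|]; last exact: IHp.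
  have [C [d [cC dC xC sC dx]]] := path_circuit xA cx.
  have oC : orients C d by case/andP: dC.
  have := forallP (forallP tf C) d; rewrite cC dC /= => /eqP.
  have cplx : coupling [set: E] (arr e) C d x = 1 by rewrite /coupling !inE xC dx eqxx.
  rewrite (bigD1 x) //= cplx mulr1z => sf.
  have := direction_sum_eq0 p dC; rewrite (bigD1 x) //= dx => sp.
  apply: (addIr (\sum_(i in C | i != x) (p (d i).2 - p (d i).1))).
  rewrite sp -[RHS]sf; congr (_ + _); apply: eq_bigr => y /andP[yC yx].
  rewrite -(dpot_coupling e p oC yC) -IHp //.
  by have := subsetP sC y yC; rewrite !inE (negPf yx).
pose c := f x - dpot e p x.
exists (fun w => p w + if connect (adj A) (hd e x) w then c else 0) => y.
rewrite inE /dpot => /predU1P[->|ys].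
  by rewrite connect0 (negPf ncx) addr0 addrAC -/(dpot e p x) addrC subrK.
have yA : y \in A by rewrite inE.
have -> : connect (adj A) (hd e x) (tl e y) = connect (adj A) (hd e x) (hd e y).
  by apply: same_connect1r; [apply: connect_adj_sym|apply: adj_arr].
by rewrite opprD addrACA subrr addr0; apply: IHp.
Qed.

(** The height of a vertex is the number of vertices that reach it; it grows along every arrow, as
    otherwise the arrow would close a directed circuit. Conversely, positive increments cannot sum
    to 0 around a circuit. *)
Lemma acyclicP e :
  reflect (exists h : V -> nat, forall x, (h (tl e x) < h (hd e x))%N) (is_acyclic e).
Proof.
apply: (iffP idP) => [ac|[h hP]]; last first.
  apply/forallP => C; apply/implyP => cC; apply/negP => dC.
  have := direction_sum_eq0 (fun v => (h v)%:Z) dC.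
  case/and3P: cC => /set0Pn[x xC] _ _; rewrite (bigD1 x) //= => /eqP; apply/negP.
  rewrite gt_eqF // ltr_pwDl //; first by rewrite subr_gt0 ltz_nat; apply: hP.
  by apply: sumr_ge0 => y _; rewrite subr_ge0 lez_nat; apply: ltnW (hP y).
pose D := [rel u v | [exists x, arr e x == (u, v)]].
exists (fun v => #|[set u | connect D u v]|) => x; apply: proper_card.
have Dx : D (tl e x) (hd e x) by apply/existsP; exists x; rewrite -surjective_pairing.
rewrite properE; apply/andP; split.
  by apply/subsetP => u; rewrite !inE => /connect_trans; apply; apply: connect1.
apply/subsetPn; exists (hd e x); rewrite !inE ?connect0 //.
apply/negP => /connectP[p0 p0P]; case/shortenP: p0P => p pP up _ lastp {p0}.
set s := hd e x :: p in up.
have cs : cycle D s by rewrite /s /cycle rcons_path pP -lastp.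
pose ed a := odflt x [pick y | arr e y == (a, next s a)].
have ded : {in s, forall a, arr e (ed a) = (a, next s a)}.
  move=> a sa; rewrite /ed; case: pickP => [y /eqP//|no].
  by have /existsP[y yP] := next_cycle cs sa; have := no y; rewrite yP.
have eds : {in s, forall a, ends (ed a) = [set a; next s a]}.
  by move=> a sa; rewrite -(arr_ends e) /tl /hd ded.
have [cC dC] := cycle_circuit up isT eds ded.
by have /forallP/(_ [set ed a | a in s]) := ac; rewrite cC dC.
Qed.

End GraphBasics.

(** * Cut-equivalence *)

Section CutEquivalence.

Variable G : mgraph.
Hypothesis loopless_G : loopless G.

Local Notation V := (vert G).
Local Notation E := (edge G).

Implicit Types (B D : {set E}) (S : {set V}) (u v w : V) (x y : E).
Implicit Types (e r t : orientation G).

Lemma mem_cut e S x : (x \in cut S) = ((tl e x \in S) != (hd e x \in S)).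
Proof.
have meets (U : {set V}) : (ends x :&: U != set0) = (tl e x \in U) || (hd e x \in U).
  rewrite -(arr_ends e); apply/set0Pn/orP => [[v]|[vU|vU]].
  - by rewrite !inE => /andP[/orP[]/eqP->]; auto.
  - by exists (tl e x); rewrite !inE eqxx.
  - by exists (hd e x); rewrite !inE eqxx orbT.
by rewrite inE !meets !inE; case: (_ \in S); case: (_ \in S).
Qed.

Lemma dpot_swap (M : zmodType) e r (p : V -> M) x :
  arr r x = swap (arr e x) -> dpot r p x = - dpot e p x.
Proof. by rewrite /dpot /hd /tl => ->; rewrite opprB. Qed.

Lemma dpot_same (M : zmodType) e r (p : V -> M) x :
  arr r x = arr e x -> dpot r p x = dpot e p x.
Proof. by rewrite /dpot /hd /tl => ->. Qed.

Lemma directed_cut_potential e D : is_directed_cut e D ->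
  exists a : V -> int, forall x, dpot e a x = (x \in D)%:R.
Proof.
case/existsP => S /and3P[_ /eqP-> /orP[]/forall_inP dS].
  exists (fun v => - (v \in S)%:R) => x; rewrite /dpot.
  case: (boolP (x \in cut S)) => [/dS /andP[]|].
    by rewrite -/(hd e x) -/(tl e x) => -> /negPf ->; rewrite oppr0 sub0r opprK.
  by rewrite (mem_cut e) negbK => /eqP->; rewrite subrr.
exists (fun v => (v \in S)%:R) => x; rewrite /dpot.
case: (boolP (x \in cut S)) => [/dS /andP[]|].
  by rewrite -/(hd e x) -/(tl e x) => /negPf -> ->; rewrite subr0.
by rewrite (mem_cut e) negbK => /eqP->; rewrite subrr.
Qed.

(* The upper level sets of a potential are directed cuts. *)
Lemma directed_bonds_partition e B (a : V -> int) :
  (forall x, dpot e a x = (x \in B)%:R) ->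
  exists P : {set {set E}}, partition P B && [forall D in P, is_directed_bond e D].
Proof.
have [n] := ubnP #|B|; elim: n B a => // n IHn B a ltBn aB.
have [->|[x0 x0B]] := set_0Vmem B.
  exists set0; rewrite partition_set0 eqxx /=.
  by apply/forall_inP => D; rewrite inE.
(* The cut of this level set contains [x0] and lies in [B], and all its arrows enter [S]. *)
pose S := [set v | a (hd e x0) <= a v].
have hdS : hd e x0 \in S by rewrite inE.
have tlS : tl e x0 \notin S.
  by have := aB x0; rewrite x0B /dpot inE => h; lia.
have mB x : (x \in B) = (a (tl e x) != a (hd e x)).
  have := aB x; rewrite /dpot; case: (x \in B) => h; symmetry; first by apply/eqP => h2; lia.
  by apply/negbTE; rewrite negbK; apply/eqP; lia.
have cutB : cut S \subset B.
  apply/subsetP => x; rewrite (mem_cut e) mB; apply: contraNneq => eqa.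
  by rewrite !inE eqa.
have x0S : x0 \in cut S by rewrite (mem_cut e) hdS (negPf tlS).
have dS : is_directed_cut e (cut S) && (cut S != set0).
  apply/andP; split; last by apply/set0Pn; exists x0.
  apply/existsP; exists S; rewrite eqxx /=; apply/andP; split.
    apply/andP; split; apply/set0Pn; first by exists (hd e x0).
    by exists (tl e x0); rewrite inE.
  apply/orP; right; apply/forall_inP => x xS; rewrite -/(hd e x) -/(tl e x).
  have := aB x; have := xS; rewrite (mem_cut e) (subsetP cutB) // !inE /dpot => h1 h2.
  by apply/andP; split; lia.
have [D bD DS] := minset_exists (P := fun D => is_directed_cut e D && (D != set0)) dS.
have [/andP[dD D0] _] := minsetP bD.
have [b bP] := directed_cut_potential dD.
have DB := subset_trans DS cutB.
(* Subtracting the potential of the bond [D] removes exactly [D] from [B]. *)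
have [||P /andP[pP dP]] := IHn (B :\: D) (fun v => a v - b v).
- rewrite cardsDS // (leq_trans _ (ltBn : (_ <= n)%N)) // ltn_subrL card_gt0 D0.
  by rewrite card_gt0; apply/set0Pn; exists x0.
- move=> x; rewrite dpotB aB bP inE; have := subsetP DB x.
  by case: (x \in D) => [/(_ isT)->|_]; rewrite ?subrr ?subr0.
have defB : D :|: (B :\: D) = B.
  by apply/setP => x; rewrite !inE; have := subsetP DB x; case: (x \in D) => // ->.
exists (D |: P); apply/andP; split.
  rewrite -defB; apply: partitionU1 => //; rewrite -setI_eq0.
  by apply/eqP/setP => x; rewrite !inE; case: (x \in D).
by apply/forall_inP => D'; rewrite !inE => /predU1P[->//|/(forall_inP dP)].
Qed.

(** A level set may cut out only part of [B]; the parity of [a] changes along all of [B] and nowhere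
    else. *)
Lemma odd_potential_cut e B (a : V -> int) : B != set0 ->
  (forall x, dpot e a x = (x \in B)%:R) -> is_cut B.
Proof.
case/set0Pn => x0 x0B aB; pose S := [set v | odd `|a v|].
have mB x : (x \in B) = (x \in cut S).
  rewrite (mem_cut e) !inE; have := aB x; rewrite /dpot; case: (x \in B) => /= h.
    have -> : a (hd e x) = a (tl e x) + 1 by lia.
    by symmetry; lia.
  have -> : a (hd e x) = a (tl e x) by lia.
  by rewrite eqxx.
apply/existsP; exists S; apply/andP; split; last by apply/eqP/setP.
have := mB x0; rewrite x0B (mem_cut e) => /esym neqS.
apply/andP; split; apply/set0Pn; case: (boolP (tl e x0 \in S)) neqS => tS hS.
- by exists (tl e x0).
- by exists (hd e x0); move: hS; case: (_ \in S).
- by exists (hd e x0); rewrite inE; move: hS; case: (_ \in S).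
- by exists (tl e x0); rewrite inE.
Qed.

Definition flip_potential e r (a : V -> int) :=
  forall x, dpot e a x = (arr e x != arr r x)%:R.

Lemma flip_potential_sym e r a : flip_potential e r a -> flip_potential r e (fun v => - a v).
Proof.
move=> aP x; have := aP x; rewrite eq_sym.
have [er|er] := arr_cases e r x.
  by rewrite er eqxx /dpot /hd /tl er => /eqP; rewrite subr_eq0 => /eqP->; rewrite subrr.
rewrite er eq_sym (arr_neq_swap loopless_G) /dpot /hd /tl er /= => <-.
by rewrite opprK addrC.
Qed.

(** The potentials of the directed bonds in an oriented cut add up to [a]; conversely, the level
    sets of [a] split the reversed edges into directed bonds. A cut oriented with respect to [r] is
    brought back to [e] by negating the potential. *)
Lemma cut_equivP e r : reflect (exists a, flip_potential e r a) (cut_equiv e r).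
Proof.
have oriented_pot t B : is_oriented_cut t B ->
    exists a : V -> int, forall x, dpot t a x = (x \in B)%:R.
  case/andP=> _ /existsP[P /andP[pP /forall_inP dP]].
  have H D : exists a : V -> int, D \in P -> forall x, dpot t a x = (x \in D)%:R.
    case: (boolP (D \in P)) => [/dP /minsetP[/andP[dD _] _]|]; last by exists (fun=> 0).
    by have [a aP] := directed_cut_potential dD; exists a.
  have [a aP] := fin_all_exists H.
  exists (fun v => \sum_(D in P) a D v) => x.
  rewrite /dpot -sumrB (eq_bigr (fun D => (x \in D)%:R)); last first.
    by move=> D DP; have := aP D DP x.
  have /and3P[/eqP cP tP _] := pP.
  case: (boolP (x \in B)) => xB; last first.
    apply: big1 => D DP; case: (boolP (x \in D)) => // xD; case/negP: xB.
    by rewrite -cP; apply/bigcupP; exists D.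
  have xcP : x \in cover P by rewrite cP.
  rewrite (bigD1 (pblock P x)) ?pblock_mem //= mem_pblock xcP big1 ?addr0 // => D /andP[DP].
  case: (boolP (x \in D)) => // xD.
  by rewrite -(def_pblock tP DP xD) eqxx.
apply: (iffP or3P) => [[d0|/oriented_pot[a aP]|/oriented_pot[a aP]]|[a aP]].
- exists (fun=> 0) => x; rewrite /dpot subrr.
  by have := in_set0 x; rewrite -(eqP d0) inE => ->.
- by exists a => x; rewrite aP inE.
- exists (fun v => - a v); apply: flip_potential_sym => x.
  by rewrite aP inE eq_sym.
- have [d0|d0] := eqVneq (differ e r) set0; [by constructor 1|constructor 2].
  have aD x : dpot e a x = (x \in differ e r)%:R by rewrite aP inE.
  rewrite /is_oriented_cut (odd_potential_cut d0 aD).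
  by apply/existsP; apply: directed_bonds_partition aD.
Qed.

Lemma cut_equiv_refl e : cut_equiv e e.
Proof. by apply/cut_equivP; exists (fun=> 0) => x; rewrite /dpot subrr eqxx. Qed.

Lemma cut_equiv_sym e r : cut_equiv e r = cut_equiv r e.
Proof.
by apply/cut_equivP/cut_equivP => -[a aP]; exists (fun v => - a v);
  apply: flip_potential_sym.
Qed.

(** The potentials add: an edge reversed twice contributes 1 and then -1. *)
Lemma cut_equiv_trans e r t : cut_equiv e r -> cut_equiv r t -> cut_equiv e t.
Proof.
move=> /cut_equivP[a aP] /cut_equivP[b bP]; apply/cut_equivP.
exists (fun v => a v + b v) => x; rewrite {1}/dpot opprD addrACA -!/(dpot _ _ _) aP.
have := bP x; have n := arr_neq_swap loopless_G.
have [er|er] := arr_cases e r x; have [rt|rt] := arr_cases r t x.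
- by rewrite (dpot_same _ er) rt er eqxx => ->; rewrite addr0.
- by rewrite (dpot_same _ er) rt er eqxx n => ->; rewrite add0r.
- by rewrite (dpot_swap _ er) rt er eqxx n => /eqP; rewrite oppr_eq0 => /eqP->; rewrite addr0.
- rewrite (dpot_swap _ er) rt n er n => /eqP; rewrite eqr_oppLR => /eqP->.
  by rewrite /swap -surjective_pairing eqxx subrr.
Qed.

(** The potential drops by 1 along each reversed arrow of [r] and is constant along the others, so
    [h] minus [M] times [a] is a height for [r] once [M] exceeds all values of [h]. The shift by [m]
    keeps it a natural number. *)
Lemma cut_equiv_acyclic e r : cut_equiv e r -> is_acyclic e -> is_acyclic r.
Proof.
move=> /cut_equivP[a aP] /(acyclicP loopless_G)[h hP]; apply/(acyclicP loopless_G).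
pose M := (\max_v h v).+1; pose m := (\sum_v `|a v|)%N.
have am v : - m%:Z <= a v <= m%:Z.
  have : (`|a v| <= m)%N by rewrite /m (bigD1 v) //= leq_addr.
  lia.
pose g v := (h v + M * `|m%:Z - a v|)%N.
have gE v : (g v)%:Z = (h v)%:Z + M%:Z * (m%:Z - a v).
  by rewrite /g PoszD PoszM gez0_abs // subr_ge0; have /andP[] := am v.
exists g => x; rewrite -ltz_nat -subr_gt0 !gE.
have := aP x; have := hP x; have : (h (hd e x) < M)%N by rewrite ltnS leq_bigmax.
have [er|er] := arr_cases e r x; rewrite er /dpot /hd /tl er.
  rewrite eqxx => _ hx /eqP; rewrite subr_eq0 => /eqP ->.
  by rewrite opprD addrACA subrr addr0 subr_gt0 ltz_nat.
rewrite (arr_neq_swap loopless_G) /swap /=.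
move=> h1 h2 ax; have -> : a (arr e x).2 = a (arr e x).1 + 1 by lia.
nia.
Qed.

Lemma mem_ac_class e c : c \in ac_classes G -> e \in c ->
  is_acyclic e /\ forall r, (r \in c) = cut_equiv e r.
Proof.
case/imsetP=> t; rewrite !inE => act ->; rewrite !inE => /andP[ace te]; split=> // r.
rewrite !inE; apply/andP/idP => [[_ tr]|er].
  by rewrite cut_equiv_sym in te; apply: cut_equiv_trans te tr.
by split; [apply: cut_equiv_acyclic er ace|apply: cut_equiv_trans te er].
Qed.

Lemma partition_ac_classes : partition (ac_classes G) (acyclics G).
Proof.
apply: equivalence_partitionP => e r t _ _ _; split=> [|er]; first exact: cut_equiv_refl.
apply/idP/idP; last exact: cut_equiv_trans er.
by apply: cut_equiv_trans; rewrite cut_equiv_sym.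
Qed.

End CutEquivalence.

(** * Bounded tensions and monotone maps *)

Lemma digit_unique (q k l x y : int) :
  0 <= x < q -> 0 <= y < q -> q * k + x = q * l + y -> x = y.
Proof.
move=> hx hy h; have : q * (k - l) = y - x by lia.
have q0 : 0 <= q by lia.
set m := k - l; clearbody m; case: (ltrgtP m 0) => [m0|m0|->]; last by lia.
  by have := @ler_wpM2l _ q q0 m (-1); lia.
by have := @ler_wpM2l _ q q0 1 m; lia.
Qed.

Definition agree (V T : finType) (R : {set V}) (b c : {ffun V -> T}) : bool :=
  [forall v in R, b v == c v].

Lemma card_agree (V T : finType) (R : {set V}) (b : {ffun V -> T}) :
  #|[set c | agree R b c]| = (#|T| ^ #|~: R|)%N.
Proof.
pose F v : pred T := if v \in R then pred1 (b v) else predT.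
have -> : #|[set c | agree R b c]| = #|(family F : simpl_pred {ffun V -> T})|.
  apply: eq_card => c; rewrite inE; apply/forall_inP/familyP => [bc v|Fc v vR].
    by rewrite /F; case: ifPn => [/bc/eqP->|//]; rewrite !inE.
  by have := Fc v; rewrite /F vR !inE eq_sym.
rewrite card_family foldrE big_map big_enum /= (bigID (mem R)) /= big1 => [|v vR].
  rewrite mul1n -prod_nat_const; apply: eq_big => v; first by rewrite inE.
  by rewrite /F => /negPf->; apply: eq_card.
by rewrite /F vR card1.
Qed.

(* Double counting of the pairs (b, c) that agree on R. *)
Lemma sum_agree (V T : finType) (R : {set V}) (w : {ffun V -> T} -> nat) (n : nat) :
  (0 < #|T|)%N -> (forall c, \sum_(b | agree R b c) w b = n)%N ->
  (\sum_b w b = n * #|T| ^ #|R|)%N.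
Proof.
move=> T0 wn; apply/eqP; rewrite -(eqn_pmul2r (_ : 0 < #|T| ^ #|~: R|)%N) ?expn_gt0 ?T0 //.
rewrite -mulnA -expnD cardsC -card_ffun.
have -> : (n * #|{ffun V -> T}| = \sum_(c : {ffun V -> T}) n)%N.
  by rewrite big_const iter_addn_0.
rewrite -(eq_bigr _ (fun c _ => wn c)) (exchange_big_dep predT) //= big_distrl /=.
apply/eqP; apply: eq_bigr => b _; rewrite sum_nat_const -(card_agree R b) mulnC.
by congr (_ * _)%N; apply: eq_card => c; rewrite [LHS]in_set.
Qed.

Section Coloring.

Variable G : mgraph.
Hypothesis loopless_G : loopless G.

Local Notation V := (vert G).
Local Notation E := (edge G).

Implicit Types (B : {set E}) (S : {set V}) (u v w : V) (x y : E).
Implicit Types (e r t : orientation G).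

Definition reps : {set V} := [set v in roots (adj [set: E])].

Definition rep_of v : V := fingraph.root (adj [set: E]) v.

Lemma rep_ofP v : rep_of v \in reps.
Proof. by rewrite inE; apply: roots_root; apply: connect_adj_sym. Qed.

Lemma rep_of_id v : v \in reps -> rep_of v = v.
Proof. by rewrite inE => /eqP. Qed.

Lemma card_reps : #|reps| = k_comp G.
Proof. by apply: eq_card => v; rewrite !inE andbT. Qed.

Lemma rk_reps : rk G = #|~: reps|.
Proof. by rewrite /rk -card_reps -(cardsC reps) addKn. Qed.

Lemma rep_of_arr e x : rep_of (hd e x) = rep_of (tl e x).
Proof.
apply/eqP; rewrite root_connect; last exact: connect_adj_sym.
by rewrite connect_adj_sym; apply/connect1/adj_arr; rewrite inE.
Qed.

Lemma dpot_eq0 (M : zmodType) e (p : V -> M) :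
  (forall x, dpot e p x = 0) -> forall v, p v = p (rep_of v).
Proof.
move=> p0 v.
have cl : closed (adj [set: E]) [pred w | p w == p v].
  apply: intro_closed => [|u w /existsP[x /andP[_ /eqP ex]]]; first exact: connect_adj_sym.
  rewrite !inE => /eqP <-; move/eqP: (p0 x); rewrite subr_eq0 => /eqP px.
  by move: ex; rewrite -(arr_ends e) => /set2_eq[[<- <-]|[<- <-]]; apply/eqP.
have := closed_connect cl (connect_root (adj [set: E]) v).
by rewrite !inE eqxx => /esym/eqP->.
Qed.

Lemma tension_normalized (M : zmodType) e (f : {ffun E -> M}) (c : V -> M) :
  is_tension e f ->
  exists2 p : V -> M, forall x, f x = dpot e p x & {in reps, p =1 c}.
Proof.
move=> /(tension_dpot loopless_G)[p pP].
exists (fun v => p v - p (rep_of v) + c (rep_of v)) => [x|v /rep_of_id->].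
  by rewrite pP /dpot rep_of_arr opprD addrACA subrr addr0 opprB addrA subrK.
by rewrite subrr add0r.
Qed.

Lemma flip_orients e B :
  orients [set: E] [ffun x => if x \in B then swap (arr e x) else arr e x].
Proof.
apply/forall_inP => x _; rewrite ffunE -(arr_ends e) /tl /hd.
by case: ifP => _ //=; rewrite setUC.
Qed.

Definition flip e B : orientation G := Sub _ (flip_orients e B).

Lemma arr_flip e B x : arr (flip e B) x = if x \in B then swap (arr e x) else arr e x.
Proof. by rewrite /arr /= ffunE. Qed.

Lemma flip_neq e B x : (arr e x != arr (flip e B) x) = (x \in B).
Proof. by rewrite arr_flip; case: ifP; rewrite ?eqxx // arr_neq_swap. Qed.

Lemma orientation_inj e r : (forall x, arr e x = arr r x) -> e = r.
Proof. by move=> er; apply/val_inj/ffunP. Qed.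

Definition arrow_rel r : rel V := [rel u v | [exists x, arr r x == (u, v)]].

Lemma arrow_relP r u v : reflect (exists x, tl r x = u /\ hd r x = v) (arrow_rel r u v).
Proof.
apply: (iffP existsP) => -[x].
  by move=> /eqP rx; exists x; rewrite /tl /hd rx.
by case=> <- <-; exists x; rewrite -surjective_pairing.
Qed.

Lemma arrow_rel_acyclic r :
  is_acyclic r -> exists h : V -> nat, forall u v, arrow_rel r u v -> (h u < h v)%N.
Proof.
move=> /(acyclicP loopless_G)[h hP]; exists h => u v /arrow_relP[x [<- <-]]; exact: hP.
Qed.

(** * Bounded tensions as pairs of a cut-equivalent orientation and a monotone map *)

Section Box.

Variable N : nat.
Local Notation q := N.+1.
Implicit Types (s : bool) (b c : {ffun V -> 'I_N.+1}).

Definition monotone s r : {set {ffun V -> 'I_N.+1}} :=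
  order_maps (arrow_rel r) N s N.+1 [set: V].

Lemma monotoneP s r b :
  reflect (forall x, (s + b (tl r x) <= b (hd r x))%N) (b \in monotone s r).
Proof.
apply: (iffP (order_mapsP _ _ _ _ _)) => [[_ _ mb] x|mb].
  by apply: mb; rewrite ?inE //; apply/arrow_relP; exists x.
by split=> [v _|v|u v _ _ /arrow_relP[x [<- <-]]]; rewrite ?inE ?ltn_ord ?mb.
Qed.

(** Since [q] is [N.+1], the type ['I_N.+2] already expresses values from 0 to [q]; only the strict
    case adds a condition. *)
Definition box_tensions s e : {set {ffun E -> 'I_N.+2}} :=
  [set f : {ffun E -> 'I_N.+2} | is_tension e [ffun x => (f x)%:Z] &&
     [forall x, s ==> (0 < f x < q)%N]].

(* The potential of a tension with values in [0, q] is q a + b, where a is a flip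
   potential of some r and b is monotone along r. *)
Definition box_of e (rb : orientation G * {ffun V -> 'I_N.+1}) : {ffun E -> 'I_N.+2} :=
  [ffun x => inord (q * (arr e x != arr rb.1 x) + rb.2 (hd e x) - rb.2 (tl e x))%N].

(** Monotonicity of [b] along [r] keeps the value between 0 and [q], so neither the subtraction of
    naturals nor [inord] in [box_of] loses anything. *)
Lemma box_ofE s e r b x : b \in monotone s r ->
  (box_of e (r, b) x)%:Z =
    q%:Z * (arr e x != arr r x)%:R + dpot e (fun v => (b v)%:Z) x /\
  (s ==> (0 < box_of e (r, b) x < q)%N).
Proof.
move=> /monotoneP/(_ x) mb; rewrite /dpot ffunE /=.
have := ltn_ord (b (hd e x)); have := ltn_ord (b (tl e x)).
have [er|er] := arr_cases e r x; move: mb; rewrite /hd /tl er ?eqxx /=.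
  case: s => mb lt1 lt2; rewrite inordK; lia.
rewrite (arr_neq_swap loopless_G) /=.
case: s => mb lt1 lt2; rewrite inordK; lia.
Qed.

(** The values on [reps] are prescribed by an arbitrary [c]: taking [c] zero gives polynomials that
    can be read at 0, and running over all [c] gives the unnormalised maps. *)
Definition lifts s e c : {set orientation G * {ffun V -> 'I_N.+1}} :=
  [set rb | [&& cut_equiv e rb.1, rb.2 \in monotone s rb.1 & agree reps rb.2 c]].

Lemma in_lifts s e c r b : ((r, b) \in lifts s e c) =
  [&& cut_equiv e r, b \in monotone s r & agree reps b c].
Proof. by rewrite [LHS]in_set. Qed.

(** Equal tensions have potentials that differ by a constant on each component. At its
    representative the remainders agree, so the constant is a multiple of [q] and the remainders
    agree everywhere. *)
Lemma box_of_inj s e c : {in lifts s e c &, injective (box_of e)}.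
Proof.
move=> [r b] [r' b']; rewrite !in_lifts.
case/and3P=> /(cut_equivP loopless_G)[a aP] mb /forall_inP bc.
case/and3P=> /(cut_equivP loopless_G)[a' aP'] mb' /forall_inP bc' eqf.
have eqx x : q%:Z * (arr e x != arr r x)%:R + dpot e (fun v => (b v)%:Z) x =
    q%:Z * (arr e x != arr r' x)%:R + dpot e (fun v => (b' v)%:Z) x.
  by have [<- _] := box_ofE e x mb; have [<- _] := box_ofE e x mb'; rewrite eqf.
pose p v := q%:Z * (a v - a' v) + ((b v)%:Z - (b' v)%:Z).
have p0 x : dpot e p x = 0.
  have := eqx x; rewrite -aP -aP' /dpot /p => h.
  apply/eqP; rewrite subr_eq0; apply/eqP; move: h; lia.
have eqb : b = b'.
  apply/ffunP => v; apply: val_inj; have := dpot_eq0 p0 v; rewrite /p.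
  have /eqP -> := bc _ (rep_ofP v); have /eqP -> := bc' _ (rep_ofP v).
  rewrite subrr addr0 addrA => /eqP; rewrite subr_eq => /eqP h.
  apply/eqP; rewrite -eqz_nat; apply/eqP.
  by apply: (@digit_unique q _ _ _ _ _ _ h); rewrite /= ltz_nat ltn_ord.
subst b'; congr (_, _); apply: orientation_inj => x; have := eqx x => /addIr.
have q0 : q%:Z != 0 by [].
move=> /(mulfI q0).
have [->|->] := arr_cases e r x; have [->|->] := arr_cases e r' x => //;
  by rewrite eqxx (arr_neq_swap loopless_G).
Qed.

Lemma box_of_onto s e c : box_of e @: lifts s e c = box_tensions s e.
Proof.
apply/setP => f; apply/imsetP/idP => [[[r b]]|].
  rewrite in_lifts => /and3P[/(cut_equivP loopless_G)[a aP] mb _] ->.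
  rewrite inE; apply/andP; split.
    apply: (@dpot_tension _ loopless_G _ e (fun v => q%:Z * a v + (b v)%:Z)) => x.
    by rewrite ffunE; have [-> _] := box_ofE e x mb; rewrite -aP /dpot mulrBr [in RHS]opprD addrACA.
  by apply/forallP => x; have [_ ->] := box_ofE e x mb.
rewrite inE => /andP[/(tension_normalized (fun v => (c v)%:Z))[p pP pc] /forallP f0].
have {}pP x : (f x)%:Z = dpot e p x by rewrite -pP ffunE.
pose a v := (p v %/ q%:Z)%Z; pose b : {ffun V -> 'I_N.+1} := [ffun v => inord `|(p v %% q%:Z)%Z|%N].
have bE v : (b v)%:Z = (p v %% q%:Z)%Z.
  have m0 : 0 <= (p v %% q%:Z)%Z by apply: modz_ge0.
  have mq : (p v %% q%:Z)%Z < q%:Z by apply: ltz_pmod.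
  by rewrite ffunE /= inordK; lia.
have pE v : p v = q%:Z * a v + (b v)%:Z by rewrite bE /a mulrC -divz_eq.
have daE x : (f x)%:Z = q%:Z * dpot e a x + dpot e (fun v => (b v)%:Z) x.
  by rewrite pP /dpot !pE; lia.
(* Increments of remainders lie strictly between [- q] and [q], and [f x] lies between 0 and [q], so
   the increment of the quotient is above -1 and below 2. *)
have da x : (dpot e a x == 0) || (dpot e a x == 1).
  have := daE x; have := ltn_ord (b (hd e x)); have := ltn_ord (b (tl e x)); have := ltn_ord (f x).
  rewrite {2}/dpot; set k := dpot e a x; nia.
pose r := flip e [set x | dpot e a x == 1].
have aP : flip_potential e r a.
  by move=> x; rewrite /r flip_neq inE; have /orP[/eqP->|/eqP->] := da x.
have mb : b \in monotone s r.
  apply/monotoneP => x; have := daE x; have /implyP := f0 x; have := ltn_ord (f x).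
  rewrite /r /hd /tl arr_flip inE /dpot /swap -/(hd e x) -/(tl e x) -/(dpot e a x).
  have /orP[/eqP->|/eqP->] /= := da x; rewrite -?/(hd e x) -?/(tl e x); case: s {f0} => h1 h2 h3.
  - by have := h2 isT; lia.
  - by lia.
  - by have := h2 isT; lia.
  - by lia.
exists (r, b).
  rewrite in_lifts mb; apply/andP; split; first by apply/cut_equivP => //; exists a.
  apply/forall_inP => v vR; apply/eqP/val_inj/eqP; rewrite -eqz_nat bE pc //.
  by rewrite modz_small // ltz_nat ltn_ord.
apply/ffunP => x; apply: val_inj; apply/eqP; rewrite -eqz_nat.
by have [-> _] := box_ofE e x mb; rewrite -aP daE.
Qed.

Lemma card_lifts s e c : (\sum_(r | cut_equiv e r) #|[set b in monotone s r | agree reps b c]| =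
  #|box_tensions s e|)%N.
Proof.
rewrite -(box_of_onto s e c) (card_in_imset (@box_of_inj s e c)) -sum1_card.
under eq_bigr => r _ do rewrite -sum1_card.
by rewrite pair_big_dep; apply: eq_bigl => -[r b]; rewrite in_lifts in_set.
Qed.

(** Every choice of values on [reps] admits the same number of lifts; summing over the choices frees
    these values at the cost of a power of [q]. *)
Lemma card_box_tensions s e :
  (#|box_tensions s e| * q ^ #|reps| = \sum_(r | cut_equiv e r) #|monotone s r|)%N.
Proof.
have := @sum_agree _ _ reps (fun b => \sum_(r | cut_equiv e r) (b \in monotone s r))%N
  #|box_tensions s e|; rewrite card_ord => <- //; last move=> c.
- rewrite exchange_big /=; apply: eq_bigr => r _.
  by rewrite -big_mkcond sum1_card.
- rewrite -(card_lifts s e c) exchange_big /=; apply: eq_bigr => r _.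
by rewrite -big_mkcondr -sum1_card; apply: eq_bigl => b; rewrite in_set andbC.
Qed.

End Box.

End Coloring.

(** * Proper colorings *)

Section ProperColorings.

Variable G : mgraph.
Hypothesis loopless_G : loopless G.

Local Notation V := (vert G).
Local Notation E := (edge G).

Implicit Types (u v w : V) (x y : E) (e r : orientation G).

Definition proper (T : finType) e : {set {ffun V -> T}} :=
  [set b : {ffun V -> T} | [forall x, b (hd e x) != b (tl e x)]].

Lemma properP (T : finType) e (b : {ffun V -> T}) :
  reflect (forall x, b (hd e x) != b (tl e x)) (b \in proper T e).
Proof. by rewrite inE; apply: forallP. Qed.

(** Used in both directions, it shows that the count depends only on the number of colors, so a
    group can be replaced by ordinals, which carry an order. *)
Lemma leq_card_proper (T1 T2 : finType) e :
  (#|T1| <= #|T2|)%N -> (#|proper T1 e| <= #|proper T2 e|)%N.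
Proof.
move=> le12; pose g (a : T1) : T2 := enum_val (widen_ord le12 (enum_rank a)).
have g_inj : injective g.
  by move=> a b /enum_val_inj/(congr1 val)/= /val_inj/enum_rank_inj.
pose gg (b : {ffun V -> T1}) : {ffun V -> T2} := [ffun v => g (b v)].
have gg_inj : injective gg.
  by move=> b c /ffunP bc; apply/ffunP => v; have := bc v; rewrite !ffunE => /g_inj.
rewrite -(card_imset _ gg_inj); apply/subset_leq_card/subsetP => _ /imsetP[b /properP bP ->].
by apply/properP => x; rewrite !ffunE (inj_eq g_inj).
Qed.

(** Once the values on [reps] are prescribed, the coboundary is a bijection from proper colorings to
    nowhere-zero tensions. *)
Lemma card_nz_tensions (A : finZmodType) e :
  (#|nz_tensions A e| * #|A| ^ #|reps G| = #|proper A e|)%N.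
Proof.
have A0 : (0 < #|A|)%N by apply/card_gt0P; exists 0.
rewrite -(sum_agree (R := reps G) (w := fun b => (b \in proper A e) : nat) A0).
  by rewrite -big_mkcond sum1_card.
move=> c; rewrite -big_mkcondr sum1dep_card /=.
pose dp (b : {ffun V -> A}) : {ffun E -> A} := [ffun x => dpot e b x].
rewrite -(card_in_imset (f := dp)).
  apply: eq_card => f; apply/imsetP/idP => [[b]|].
    rewrite inE => /andP[_ /properP bP] ->; rewrite inE; apply/andP; split.
      by apply: (@dpot_tension _ loopless_G _ e b) => x; rewrite ffunE.
    by apply/forallP => x; rewrite ffunE /dpot subr_eq0.
  rewrite inE => /andP[/(tension_normalized loopless_G c)[p pP pc] /forallP f0].
  have fP x : f x = dpot e [ffun v => p v] x by rewrite pP /dpot !ffunE.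
  exists [ffun v => p v]; last by apply/ffunP => x; rewrite ffunE fP.
  rewrite inE; apply/andP; split; first by apply/forall_inP => v /pc pv; rewrite ffunE pv.
  by apply/properP => x; rewrite -subr_eq0 -[_ - _]/(dpot e _ x) -fP.
move=> b b'; rewrite !in_set => /andP[/forall_inP bc _] /andP[/forall_inP bc' _] /ffunP eqd.
have p0 x : dpot e (fun v => b v - b' v) x = 0.
  by have := eqd x; rewrite dpotB !ffunE => ->; apply: subrr.
apply/ffunP => v; have /eqP := dpot_eq0 p0 v.
have /eqP -> := bc _ (rep_ofP v); have /eqP -> := bc' _ (rep_ofP v).
by rewrite subrr subr_eq0 => /eqP.
Qed.

Lemma orient_by e (h : V -> nat) : (forall x, h (hd e x) != h (tl e x)) ->
  exists2 r, is_acyclic r & forall x, (h (tl r x) < h (hd r x))%N.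
Proof.
move=> hn; pose r := flip e [set x | (h (hd e x) < h (tl e x))%N].
have rP x : (h (tl r x) < h (hd r x))%N.
  rewrite /hd /tl arr_flip inE -/(tl e x) -/(hd e x).
  by have := hn x; case: ifP => //; rewrite -/(tl e x) -/(hd e x) neq_ltn => ->.
by exists r => //; apply/acyclicP => //; exists h.
Qed.

Lemma card_proper N e :
  #|proper 'I_N.+1 e| = (\sum_(r : orientation G | is_acyclic r) #|monotone N true r|)%N.
Proof.
transitivity (\sum_(r : orientation G | is_acyclic r)
    \sum_(b in proper 'I_N.+1 e) (b \in monotone N true r))%N; last first.
  apply: eq_bigr => r _; rewrite -big_mkcondr sum1_card /=; apply: eq_card => b.
  rewrite [LHS]unfold_in /= andb_idl // => /monotoneP mb; apply/properP => x.
  have := mb x; rewrite /hd /tl; have [->|->] := arr_cases r e x => /=;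
    by rewrite add1n => lt; rewrite -val_eqE /= neq_ltn lt ?orbT.
rewrite exchange_big /= -sum1_card; apply: eq_bigr => b /properP bP.
have [r acr rP] := orient_by (h := fun v => b v) bP.
have mr : b \in monotone N true r by apply/monotoneP => x; rewrite add1n.
rewrite (bigD1 r) //= mr big1 ?addn0 // => t /andP[_ tr]; apply/eqP; rewrite eqb0.
apply: contra tr => /monotoneP mt; apply/eqP/orientation_inj => x.
have := mt x; have := rP x; rewrite /hd /tl; have [->|->] := arr_cases r t x => //= lt1.
by rewrite add1n ltnNge (ltnW lt1).
Qed.

Lemma card_nz_monotone (A : finZmodType) N e : #|A| = N.+1 ->
  (#|nz_tensions A e| * N.+1 ^ #|reps G| =
   \sum_(r : orientation G | is_acyclic r) #|monotone N true r|)%N.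
Proof.
move=> cA; rewrite -(card_proper _ e) -{1}cA card_nz_tensions.
by apply/eqP; rewrite eqn_leq !leq_card_proper // cA card_ord.
Qed.

(** Every map is weakly increasing along some acyclic orientation. This is the growth that bounds
    the degree from below. *)
Lemma leq_card_weak N e :
  (N.+1 ^ #|V| <= \sum_(r : orientation G | is_acyclic r) #|monotone N false r|)%N.
Proof.
rewrite -[in leqLHS](card_ord N.+1) -card_ffun -sum1_card.
under [leqRHS]eq_bigr => r _ do rewrite -sum1_card.
rewrite (exchange_big_dep predT) //=; apply: leq_sum => b _.
(* Vertices are ordered by [b], with ties broken by their enumeration. *)
pose h v := (b v * #|V| + enum_rank v)%N.
have hlt u v : (b u < b v)%N -> (h u < h v)%N.
  move=> lt; apply: (@leq_trans (b u * #|V| + #|V|)); first by rewrite ltn_add2l ltn_ord.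
  by rewrite -mulSnr (leq_trans _ (leq_addr _ _)) // leq_mul2r lt orbT.
have [|r acr rP] := @orient_by e h.
  move=> x; apply/eqP => eqh; have := tl_neq_hd loopless_G e x.
  case: (ltngtP (b (hd e x)) (b (tl e x))) => [/hlt|/hlt|eqb]; rewrite ?eqh ?ltnn //.
  move: eqh; rewrite /h eqb => /addnI /val_inj/enum_rank_inj ->.
  by rewrite eqxx.
have mr : b \in monotone N false r.
  apply/monotoneP => x; rewrite add0n leqNgt; apply/negP => /hlt.
  by rewrite ltnNge ltnW.
by rewrite (bigD1 r) //= acr.
Qed.

Lemma orientation_exists : exists e : orientation G, True.
Proof.
have H x : exists a : V * V, [set a.1; a.2] == ends x.
  have /eqP/cards2P[u [v [_ ->]]] := loopless_G x.
  by exists (u, v); apply: eqxx.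
have [d dP] := fin_all_exists H.
have dO : orients [set: E] [ffun x => d x].
  by apply/forall_inP => x _; rewrite ffunE.
by exists (Sub _ dO).
Qed.

End ProperColorings.

(** * Tension polynomials *)

Lemma poly_eq_on_nat (p p' : {poly rat}) :
  (forall n : nat, p.[n.+1%:R] = p'.[n.+1%:R]) -> p = p'.
Proof.
move=> eqp; apply/eqP; rewrite -subr_eq0; apply: contraT => p0.
pose s := [seq (n.+1%:R : rat) | n <- iota 0 (size (p - p'))].
have : (size s < size (p - p')%R)%N.
  apply: max_poly_roots => //.
    by apply/allP => _ /mapP[n _ ->]; rewrite rootE hornerD hornerN eqp subrr.
  by rewrite map_inj_uniq ?iota_uniq // => m n /eqP; rewrite eqr_nat => /eqP[].
by rewrite size_map size_iota ltnn.
Qed.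

(** For positive [d], a polynomial of size at most [d] is bounded at x >= 1 by C x^(d - 1), with [C]
    the sum of the absolute values of its coefficients, and this is less than x^d once x > C. *)
Lemma size_poly_lower (p : {poly rat}) (d : nat) :
  (forall n : nat, n.+1%:R ^+ d <= p.[n.+1%:R]) -> (d < size p)%N.
Proof.
move=> pd; rewrite ltnNge; apply/negP => sp.
case: d pd sp => [|d] pd sp.
  have := pd 0; move: sp; rewrite leqn0 size_poly_eq0 => /eqP->.
  by rewrite horner0 expr0 ler10.
pose C : rat := \sum_(i < size p) `|p`_i|.
have /archi_boundP : 0 <= C by apply: sumr_ge0.
set m := Num.bound C => ltC.
have x1 : 1 <= m.+1%:R :> rat by rewrite ler1n.
have : m.+1%:R ^+ d.+1 <= C * m.+1%:R ^+ d.
  apply: le_trans (pd m) _; rewrite horner_coef mulr_suml; apply: ler_sum => i _.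
  apply: le_trans (ler_norm _) _; rewrite normrM ler_wpM2l // ger0_norm ?exprn_ge0 //.
  by apply: ler_weXn2l => //; rewrite -ltnS (leq_trans (ltn_ord i)).
rewrite exprS ler_pM2r ?exprn_gt0 ?ltr0n // leNgt (lt_trans ltC) //.
by rewrite ltr_nat.
Qed.

Lemma comp_polyXnN (k : nat) (p : {poly rat}) :
  ('X^k * p) \Po - 'X = (-1) ^+ k *: ('X^k * (p \Po - 'X)).
Proof.
by rewrite comp_polyM comp_Xn_poly [in LHS]exprNn -[RHS]mul_polyC polyC_exp polyCN mulrA.
Qed.

Section TensionPolynomials.

Variable G : mgraph.
Hypothesis loopless_G : loopless G.

Local Notation V := (vert G).
Local Notation E := (edge G).

Implicit Types (u v w : V) (x y : E) (e r : orientation G).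

(* The vertices where a weakly monotone map vanishing on reps is forced to be 0. *)
Definition below r : {set V} :=
  [set v | [exists w in reps G, connect (arrow_rel r) v w]].

Lemma reps_below r : reps G \subset below r.
Proof. by apply/subsetP => v vR; rewrite inE; apply/exists_inP; exists v. Qed.

Lemma below_arr r x : hd r x \in below r -> tl r x \in below r.
Proof.
rewrite !inE => /exists_inP[w wR cw]; apply/exists_inP; exists w => //.
by apply: connect_trans cw; apply: connect1; apply/arrow_relP; exists x.
Qed.

(** Zeros spread backwards along arrows from [reps G] to all of [below r]. No arrow enters [below r]
    from outside, and an arrow leaving it imposes nothing on a weak map, so only the arrows inside
    the complement matter. *)
Lemma monotone_zero_reps N r :
  [set b in monotone N false r | agree (reps G) b [ffun=> ord0]] =
  order_maps (arrow_rel r) N false N.+1 (~: below r).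
Proof.
apply/setP => b; rewrite in_set; apply/andP/order_mapsP =>
  [[/monotoneP mb /forall_inP b0]|[_ b0 mb]].
  have bc v w : connect (arrow_rel r) v w -> (b v <= b w)%N.
    case/connectP => p pP ->; elim: p v pP => //= u p IHp v /andP[/arrow_relP[x [<- <-]] /IHp].
    exact: leq_trans (mb x).
  split=> [v _|v|u v _ _ /arrow_relP[x [<- <-]]]; [exact: ltn_ord| |exact: mb].
  rewrite inE negbK inE => /exists_inP[w wR /bc].
  have /eqP -> := b0 w wR; rewrite ffunE leqn0 => /eqP bv; exact: val_inj.
split.
  apply/monotoneP => x; rewrite add0n.
  have [tb|tb] := boolP (tl r x \in below r); first by rewrite b0 // inE tb.
  apply: mb; rewrite ?in_setC //; last by apply/arrow_relP; exists x.
  by apply: contra tb; apply: below_arr.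
apply/forall_inP => v vR; rewrite ffunE b0 // inE negbK.
exact: (subsetP (reps_below r)).
Qed.

(* A flip potential from e to r increases along e and decreases along r, so it
   is constant on components if all vertices reach reps in both. *)
Lemma full_below_unique e r : cut_equiv e r ->
  below e = [set: V] -> below r = [set: V] -> e = r.
Proof.
move=> /(cut_equivP loopless_G)[a aP] fe fr; have aP' := flip_potential_sym loopless_G aP.
have mono t (p : V -> int) : (forall x, 0 <= dpot t p x) ->
    forall v w, connect (arrow_rel t) v w -> p v <= p w.
  move=> p0 v w /connectP[s sP ->]; elim: s v sP => //= u s IHs v.
  case/andP=> /arrow_relP[x [<- <-]] /IHs.
  by apply: le_trans; rewrite -subr_ge0; apply: p0.
have reach t v : below t = [set: V] -> connect (arrow_rel t) v (rep_of v).
  move=> ft; have : v \in below t by rewrite ft.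
  rewrite inE => /exists_inP[w wR cw]; suff -> : rep_of v = w by [].
  rewrite -(rep_of_id wR); apply/eqP; rewrite root_connect; last exact: connect_adj_sym.
  apply: connect_sub cw => u u' /arrow_relP[x [<- <-]].
  by apply/connect1/adj_arr; rewrite inE.
have eqa v : a v = a (rep_of v).
  apply/eqP; rewrite eq_le; apply/andP; split.
    by apply: (mono e) (reach e v fe) => x; rewrite aP ler0n.
  rewrite -lerN2; apply: (mono r (fun v => - a v)) (reach r v fr) => x.
  by rewrite aP' ler0n.
apply: orientation_inj => x; have := aP x.
rewrite /dpot eqa (rep_of_arr e) -eqa subrr; case: eqP => //.
Qed.

(* Flipping the cut around [below r] enlarges it, so a maximal one is full. *)
Lemma full_below_exists e : exists2 r, cut_equiv e r & below r = [set: V].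
Proof.
have [r er rmax] : exists2 r, cut_equiv e r &
    forall t, cut_equiv e t -> (#|below t| <= #|below r|)%N.
  by case: (arg_maxnP (fun r => #|below r|) (cut_equiv_refl loopless_G e)) => r er rmax; exists r.
exists r => //; apply/eqP; rewrite eqEsubset subsetT /=; apply/subsetP => v _.
apply: contraT => vb.
pose t := flip r [set x | x \in cut (below r)].
(* All arrows of this cut leave [below r], so minus its indicator is a flip potential. *)
have crt : cut_equiv r t.
  apply/cut_equivP => //; exists (fun v => - (v \in below r)%:R) => x.
  rewrite flip_neq // inE (mem_cut r) /dpot opprK.
  have := @below_arr r x; case: (hd r x \in _) => [->//|_].
  by case: (tl r x \in _).
(* Directed paths of [r] ending in [reps G] stay inside [below r], hence survive the flip. *)
have sub : below r \subset below t.
  apply/subsetP => u; rewrite inE => /exists_inP[w wR /connectP[p pP lp]].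
  have all_below : forall z p, path (arrow_rel r) z p -> last z p = w -> z \in below r.
    by move=> z p' pP' lp'; rewrite inE; apply/exists_inP; exists w => //;
      apply/connectP; exists p'.
  rewrite inE; apply/exists_inP; exists w => //.
  elim: p u pP lp => [|u' p IHp] u /=; first by move=> _ ->.
  case/andP => /arrow_relP[x [ux u'x]] pP lp.
  apply: connect_trans (IHp u' pP lp); apply: connect1; apply/arrow_relP; exists x.
  have u'b := all_below u' p pP (esym lp).
  rewrite /tl /hd arr_flip inE (mem_cut r) u'x u'b ux -ux below_arr ?u'x //.
(* [v] lies outside [below r] and its representative inside, so some edge is flipped; its new arrow
   leads into [below r] and adds a vertex. *)
have [x xcut] : exists x, x \in cut (below r).
  apply/existsP; apply: contraT; rewrite negb_exists => /forallP nc.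
  pose p w : int := (w \in below r)%:R.
  have p0 x : dpot r p x = 0.
    have := nc x; rewrite (mem_cut r) negbK /dpot /p => /eqP->; exact: subrr.
  have := dpot_eq0 p0 v; rewrite /p (negPf vb).
  by rewrite (subsetP (reps_below r)) // rep_ofP.
have [tb hb] : tl r x \in below r /\ hd r x \notin below r.
  move: xcut; rewrite (mem_cut r); have := @below_arr r x.
  by case: (hd r x \in _) => [->//|_]; case: (tl r x \in _).
have : (#|below r| < #|below t|)%N.
  apply: proper_card; rewrite properE sub; apply/subsetPn; exists (hd r x) => //.
  have [tt ht] : tl t x = hd r x /\ hd t x = tl r x by rewrite /tl /hd arr_flip inE xcut.
  by rewrite -tt below_arr // ht (subsetP sub).
by rewrite ltnNge (rmax t (cut_equiv_trans loopless_G er crt)).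
Qed.

(** * Polynomials of cut-equivalence classes and their reciprocity *)

Section Polynomials.

Variables P U : orientation G -> {set V} -> {poly rat}.

Hypothesis PU_spec : forall r, is_acyclic r -> forall J : {set V},
  [/\ (size (P r J) <= #|J|.+1)%N, U r J = (-1) ^+ #|J| *: (P r J \Po - 'X),
      (U r J).[0] = (J == set0)%:R &
      forall N q, (q <= N.+1)%N ->
        (P r J).[q%:R] = #|order_maps (arrow_rel r) N true q J|%:R /\
        (U r J).[q%:R] = #|order_maps (arrow_rel r) N false q J|%:R].

Definition weak_poly (S : {set orientation G}) : {poly rat} := \sum_(r in S) U r (~: below r).

Definition strict_poly S : {poly rat} := (-1) ^+ rk G *: (weak_poly S \Po - 'X).

Definition ac_class e : {set orientation G} := [set r | cut_equiv e r].

Lemma ac_class_acyclic e : is_acyclic e -> forall r, r \in ac_class e -> is_acyclic r.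
Proof. by move=> ace r; rewrite inE => /(cut_equiv_acyclic loopless_G); apply. Qed.

Lemma weak_poly_box e N : is_acyclic e ->
  (weak_poly (ac_class e)).[N.+1%:R] = #|box_tensions N false e|%:R.
Proof.
move=> ace; rewrite -(card_lifts loopless_G false e [ffun=> ord0]) natr_sum horner_sum.
apply: eq_big => r; rewrite inE // => er.
rewrite monotone_zero_reps.
have acr : is_acyclic r by apply: (cut_equiv_acyclic loopless_G er).
by have [_ _ _ /(_ N N.+1 (leqnn _))[_ ->]] := PU_spec acr (~: below r).
Qed.

Lemma weak_poly0 e : is_acyclic e -> (weak_poly (ac_class e)).[0] = 1.
Proof.
move=> ace; have [r er fr] := full_below_exists e.
have acr : is_acyclic r by apply: (cut_equiv_acyclic loopless_G er).
rewrite horner_sum (bigD1 r) ?inE //= big1 => [|t].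
  by have [_ _ -> _] := PU_spec acr (~: below r); rewrite fr setCT eqxx addr0.
rewrite inE => /andP[et ntr].
have act : is_acyclic t by apply: (cut_equiv_acyclic loopless_G et).
have [_ _ -> _] := PU_spec act (~: below t).
have [ct|//] := boolP (~: below t == set0); case/eqP: ntr.
rewrite cut_equiv_sym // in et.
apply: (full_below_unique (cut_equiv_trans loopless_G et er)) fr.
by rewrite -[LHS]setCK (eqP ct) setC0.
Qed.

(** At positive integers both sides count bounded tensions, once with [b] zero on [reps G] and once
    with [b] free. The right side lives on the whole vertex set, where reciprocity has the same sign
    for every [r]. *)
Lemma weak_polyXn_class e : is_acyclic e ->
  'X^(#|reps G|) * weak_poly (ac_class e) = \sum_(r in ac_class e) U r [set: V].
Proof.
move=> ace; apply: poly_eq_on_nat => N; rewrite hornerM hornerXn weak_poly_box //.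
rewrite -natrX -natrM mulnC card_box_tensions // natr_sum horner_sum.
apply/esym; apply: eq_big => r; rewrite inE // => er.
have acr : is_acyclic r by apply: (cut_equiv_acyclic loopless_G er).
by have [_ _ _ /(_ N N.+1 (leqnn _))[_ ->]] := PU_spec acr [set: V].
Qed.

Lemma class_ac_class c : c \in ac_classes G ->
  exists e, [/\ e \in c, is_acyclic e & c = ac_class e].
Proof.
move=> cP; have /set0Pn[e ec] : c != set0.
  by apply: contraTneq cP => ->; rewrite (partition0 (partition_ac_classes loopless_G)).
have [ace cE] := mem_ac_class loopless_G cP ec.
by exists e; split=> //; apply/setP => r; rewrite cE inE.
Qed.

Lemma sum_acyclics (M : nmodType) (F : orientation G -> M) :
  \sum_(r in acyclics G) F r = \sum_(c in ac_classes G) \sum_(r in c) F r.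
Proof. exact: set_partition_big (partition_ac_classes loopless_G). Qed.

Lemma weak_poly_acyclics :
  weak_poly (acyclics G) = \sum_(c in ac_classes G) weak_poly c.
Proof. exact: sum_acyclics. Qed.

Lemma weak_polyXn :
  'X^(#|reps G|) * weak_poly (acyclics G) = \sum_(r in acyclics G) U r [set: V].
Proof.
rewrite weak_poly_acyclics mulr_sumr sum_acyclics; apply: eq_bigr => c cP.
by have [e [_ ace ->]] := class_ac_class cP; apply: weak_polyXn_class.
Qed.

Lemma card_vert : #|V| = (#|reps G| + rk G)%N.
Proof. by rewrite rk_reps cardsC. Qed.

(** Reflection turns each [U r] on the whole vertex set into [P r] with the sign of [#|V|], which is
    [#|reps G| + rk G]; the power of ['X] accounts for the first summand, the definition of
    [strict_poly] for the second. *)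
Lemma strict_polyXn (S : {set orientation G}) : (forall r, r \in S -> is_acyclic r) ->
  'X^(#|reps G|) * weak_poly S = \sum_(r in S) U r [set: V] ->
  'X^(#|reps G|) * strict_poly S = \sum_(r in S) P r [set: V].
Proof.
move=> acS /(congr1 (fun p => p \Po - 'X)); rewrite comp_polyXnN => eqS.
have eqP : (\sum_(r in S) U r [set: V]) \Po - 'X =
    (-1) ^+ (#|reps G| + rk G) *: \sum_(r in S) P r [set: V].
  rewrite linear_sum scaler_sumr; apply: eq_bigr => r /acS acr.
  have [_ -> _ _] := PU_spec acr [set: V].
  by rewrite /= comp_polyZ -comp_polyA raddfN /= comp_polyX opprK comp_polyXr cardsT card_vert.
rewrite eqP in eqS; rewrite /strict_poly -scalerAr; set Y := _ * _ in eqS *.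
transitivity ((-1) ^+ (#|reps G| + rk G) *: ((-1) ^+ #|reps G| *: Y)).
  by rewrite scalerA exprD mulrAC -expr2 sqrr_sign mul1r.
by rewrite eqS scalerA -expr2 sqrr_sign scale1r.
Qed.

Lemma strict_poly_box e N : is_acyclic e ->
  (strict_poly (ac_class e)).[N.+1%:R] = #|box_tensions N true e|%:R.
Proof.
move=> ace; have := strict_polyXn (ac_class_acyclic ace) (weak_polyXn_class ace).
move=> /(congr1 (fun p => p.[N.+1%:R])); rewrite hornerM hornerXn horner_sum => eqN.
have q0 : N.+1%:R ^+ #|reps G| != 0 :> rat by rewrite expf_neq0 // pnatr_eq0.
apply: (mulfI q0); rewrite {}eqN -natrX -natrM mulnC card_box_tensions // natr_sum.
apply: eq_big => r; rewrite inE // => er.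
have acr : is_acyclic r by apply: (cut_equiv_acyclic loopless_G er).
by have [_ _ _ /(_ N N.+1 (leqnn _))[-> _]] := PU_spec acr [set: V].
Qed.

Lemma strict_poly_nz (A : finZmodType) N e : #|A| = N.+1 ->
  (strict_poly (acyclics G)).[N.+1%:R] = #|nz_tensions A e|%:R.
Proof.
move=> cA; have acA r : r \in acyclics G -> is_acyclic r by rewrite inE.
have := strict_polyXn acA weak_polyXn.
move=> /(congr1 (fun p => p.[N.+1%:R])); rewrite hornerM hornerXn horner_sum => eqN.
have q0 : N.+1%:R ^+ #|reps G| != 0 :> rat by rewrite expf_neq0 // pnatr_eq0.
apply: (mulfI q0); rewrite {}eqN -natrX -natrM mulnC card_nz_monotone // natr_sum.
apply: eq_big => r; rewrite inE // => acr.
by have [_ _ _ /(_ N N.+1 (leqnn _))[-> _]] := PU_spec acr [set: V].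
Qed.

(** Both bounds are proved after multiplication by the power of ['X]: from above by the sizes of the
    order polynomials on all vertices, from below by the growth in [leq_card_weak]. *)
Lemma size_weak_poly : size (weak_poly (acyclics G)) = (rk G).+1.
Proof.
apply/eqP; rewrite eqn_leq; apply/andP; split; last first.
  have [e _] := orientation_exists loopless_G.
  apply: size_poly_lower => N.
  have q0 : 0 < N.+1%:R ^+ #|reps G| :> rat by rewrite exprn_gt0 // ltr0n.
  rewrite -(ler_pM2l q0) -exprD -card_vert -[_ ^+ #|reps G|]hornerXn -hornerM weak_polyXn.
  have -> : (\sum_(r in acyclics G) U r [set: V]).[N.+1%:R] =
      (\sum_(r : orientation G | is_acyclic r) #|monotone N false r|)%:R.
    rewrite horner_sum natr_sum; apply: eq_big => r; rewrite inE // => acr.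
    by have [_ _ _ /(_ N N.+1 (leqnn _))[_ ->]] := PU_spec acr [set: V].
  by rewrite -natrX ler_nat leq_card_weak.
have [->|w0] := eqVneq (weak_poly (acyclics G)) 0; first by rewrite size_poly0.
have : (size ('X^(#|reps G|) * weak_poly (acyclics G))%R <= #|V|.+1)%N.
  rewrite weak_polyXn (leq_trans (size_sum _ _ _)) //; apply/bigmax_leqP => r.
  rewrite inE => acr; have [sP -> _ _] := PU_spec acr [set: V].
  rewrite (leq_trans (size_scale_leq _ _)) // -cardsT (leq_trans _ sP) //.
  by rewrite size_comp_poly2 // size_polyN size_polyX.
by rewrite mulrC size_mulXn // card_vert -addnS leq_add2l.
Qed.

End Polynomials.

End TensionPolynomials.

(** * Lattice points *)

From mathcomp Require Import finmap boolp classical_sets cardinality.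

(** Exhibiting [S] as the image of a finite set is what lets [fset_set] return its elements. *)
Lemma card_fset_set_image (T : finType) (U : choiceType) (h : T -> U) (A : {set T})
    (S : classical_sets.set U) :
  injective h -> (forall u, S u <-> exists2 a, a \in A & u = h a) ->
  #|` fset_set S|%fset = #|A|.
Proof.
move=> h_inj SP.
have -> : S = [set` [fset h a | a in A]%fset]%classic.
  apply/boolp.funext => u; apply/boolp.propext; rewrite SP /=.
  split=> [[a aA ->]|/imfsetP[a aA ->]].
    by apply/imfsetP; exists a.
  by exists a.
rewrite set_fsetK card_imfset //= -cardE; exact: eq_card.
Qed.

Section LatticePoints.

Variable G : mgraph.
Hypothesis loopless_G : loopless G.
Local Notation E := (edge G).
Implicit Types (e : orientation G) (x : E).

Lemma tension_additive (M M' : zmodType) (phi : {additive M -> M'}) e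
    (f : {ffun E -> M}) (f' : {ffun E -> M'}) :
  injective phi -> (forall x, f' x = phi (f x)) -> is_tension e f' = is_tension e f.
Proof.
move=> phi_inj fE; apply: eq_forallb => C; apply: eq_forallb => d.
congr (_ ==> (_ ==> _)); rewrite -(inj_eq phi_inj) raddf0 raddf_sum; congr (_ == _).
by apply: eq_bigr => x _; rewrite fE raddfMz.
Qed.

Lemma tension_scale (M : pzRingType) (a : M) e (f : {ffun E -> M}) :
  is_tension e f -> is_tension e [ffun x => a * f x].
Proof.
case/(tension_dpot loopless_G) => p pP.
apply: (@dpot_tension _ loopless_G _ e (fun v => a * p v)) => x.
by rewrite ffunE pP /dpot mulrBr.
Qed.

Definition int_ffun N (f : {ffun E -> 'I_N.+2}) : {ffun E -> int} := [ffun x => (f x)%:Z].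

Lemma int_ffun_inj N : injective (@int_ffun N).
Proof.
move=> f f' /ffunP ff; apply/ffunP => x; apply: val_inj.
by have := ff x; rewrite !ffunE => -[].
Qed.

Lemma tau_bar_count_box (rep : {set orientation G} -> orientation G) N :
  tau_bar_count rep N.+1 = (\sum_(c in ac_classes G) #|box_tensions N false (rep c)|)%N.
Proof.
pose A : {set {set orientation G} * {ffun E -> 'I_N.+2}} :=
  [set p | (p.1 \in ac_classes G) && (p.2 \in box_tensions N false (rep p.1))].
have inord_abs (z : int) : 0 <= z <= N.+1%:Z -> (inord `|z| : 'I_N.+2)%:Z = z.
  by move=> hz; rewrite inordK; lia.
rewrite /tau_bar_count (@card_fset_set_image _ _ (fun p => (p.1, int_ffun p.2)) A).
- under [RHS]eq_bigr => c _ do rewrite -sum1_card.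
  by rewrite pair_big_dep -sum1_card; apply: eq_bigl => -[c f]; rewrite finset.in_set.
- by move=> [c f] [c' f'] [-> /int_ffun_inj ->].
- move=> [c f] /=; split=> [[/= cP tf fP]|[[c' g]]].
    exists (c, [ffun x => inord `|f x|%N]); last first.
      congr (_, _); apply/ffunP => x; rewrite !ffunE.
      exact/esym/inord_abs/fP.
    rewrite finset.in_set cP /= inE; apply/andP; split; last by apply/forallP.
    suff -> : [ffun x => ([ffun x => inord `|f x|] x : 'I_N.+2)%:Z] = f by [].
    by apply/ffunP => x; rewrite !ffunE; apply/inord_abs/fP.
  rewrite finset.in_set /= => /andP[cP]; rewrite inE => /andP[tg _] [-> ->]; split=> //= x.
  by rewrite ffunE; have := ltn_ord (g x); lia.
Qed.

(** Scaling by [N.+1] turns the lattice points into integral tensions with entries in the box; the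
    injection of the integers into [R] carries the tension condition both ways. *)
Lemma lattice_points_box (R : realType) s e N (P : classical_sets.set {ffun E -> R}) :
  (forall f, P f <-> is_tension e f /\
     forall x, if s then 0 < f x < 1 else 0 <= f x <= 1) ->
  lattice_points P N.+1 = #|box_tensions N s e|.
Proof.
move=> PP; have q0 : N.+1%:R != 0 :> R by rewrite pnatr_eq0.
have qpos : 0 < N.+1%:R :> R by rewrite ltr0n.
pose h (f : {ffun E -> 'I_N.+2}) : {ffun E -> R} := [ffun x => (f x)%:R].
have h_inj : injective h.
  move=> f f' /ffunP ff; apply/ffunP => x; apply: val_inj.
  by have := ff x; rewrite !ffunE => /eqP; rewrite eqr_nat => /eqP.
have intr_inj : injective (intr : int -> R) by apply: intr_inj.
have hT f : is_tension e (h f) = is_tension e (int_ffun f).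
  by apply: (@tension_additive _ _ intr) => // x; rewrite !ffunE.
apply: (card_fset_set_image (h := h)) => // g; split.
  case=> -[f /PP[tf fb] <-] gint.
  have fz x : exists n : 'I_N.+2, N.+1%:R * f x = n%:R /\ (s ==> (0 < n < N.+1)%N).
    have := gint x; rewrite ffunE => /intrP[z fz].
    have : 0 <= z <= N.+1%:Z /\ (s ==> (0 < z < N.+1%:Z)).
      have {fz} : f x = z%:~R / N.+1%:R by rewrite -fz mulrC mulKf.
      have := fb x; move=> /[swap] ->; case: (s).
        rewrite pmulr_lgt0 ?invr_gt0 // ltr0z ltr_pdivrMr // mul1r.
        by rewrite -[N.+1%:R]/(N.+1%:Z%:~R) ltr_int /= => zb; split; lia.
      rewrite pmulr_lge0 ?invr_gt0 // ler0z ler_pdivrMr // mul1r.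
      by rewrite -[N.+1%:R]/(N.+1%:Z%:~R) ler_int /= => zb; split; lia.
    case=> zb zs; exists (inord `|z|%N).
    have nz : (inord `|z|%N : 'I_N.+2) = `|z|%N :> nat by rewrite inordK; lia.
    rewrite nz fz; split; last by case: (s) zs => //=; lia.
    by rewrite -[ `|z|%N%:R]/(`|z|%N%:Z%:~R) gez0_abs //; lia.
  have [n nP] := fin_all_exists fz.
  exists [ffun x => n x]; last by apply/ffunP => x; rewrite !ffunE; have [] := nP x.
  rewrite inE; apply/andP; split; last first.
    by apply/forallP => x; rewrite ffunE; have [] := nP x.
  rewrite -[is_tension _ _]hT; have := tension_scale N.+1%:R tf; congr is_tension.
  by apply/ffunP => x; rewrite !ffunE; have [] := nP x.
case=> f; rewrite inE => /andP[tf /forallP fb] ->; split; last first.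
  by move=> x; rewrite /= ffunE; apply: rpred_nat.
exists [ffun x => (f x)%:R / N.+1%:R]; last first.
  by apply/ffunP => x; rewrite !ffunE mulrC divfK.
apply/PP; split.
  have := tf; rewrite -[is_tension _ _]hT => /(tension_scale N.+1%:R^-1).
  by congr is_tension; apply/ffunP => x; rewrite !ffunE mulrC.
move=> x; have := fb x; rewrite ffunE; case: s {PP fb}=> /=.
  by case/andP=> f0 fq; rewrite divr_gt0 ?ltr0n // ltr_pdivrMr // mul1r ltr_nat.
by move=> _; rewrite divr_ge0 // ler_pdivrMr // mul1r ler_nat /= -ltnS.
Qed.

End LatticePoints.

Theorem theorem1p3 (R : realType) (G : mgraph) (hG : loopless G) :
  exists (tau tau_bar : {poly rat}) (tauZ tauZ_bar : orientation G -> {poly rat}),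
  (forall (q : nat) (A : finZmodType) (e : orientation G),
     (0 < q)%N -> #|A| = q -> tau.[q%:R] = #|nz_tensions A e|%:R) /\
  (forall (q : nat) (rep : {set orientation G} -> orientation G),
     (0 < q)%N -> is_rep rep ->
     tau_bar.[q%:R] = (tau_bar_count rep q)%:R) /\
  size tau = (rk G).+1 /\
  size tau_bar = (rk G).+1 /\
  (forall e : orientation G, is_acyclic e ->
     is_ehrhart (Delta R e) (tauZ e) /\
     is_ehrhart (Delta_bar R e) (tauZ_bar e)) /\
  (forall rep : {set orientation G} -> orientation G, is_rep rep ->
     tau = \sum_(c in ac_classes G) tauZ (rep c) /\
     tau_bar = \sum_(c in ac_classes G) tauZ_bar (rep c)) /\
  tau \Po (- 'X) = (-1) ^+ rk G *: tau_bar /\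
  (-1) ^+ rk G * tau.[0] = #|ac_classes G|%:R.
Proof.
(* The guard [is_acyclic e] stands under the existential, so that finite choice yields polynomials
   for all orientations at once, with zero for those that are not acyclic. *)
have PU e : exists PU : ({set vert G} -> {poly rat}) * ({set vert G} -> {poly rat}),
    is_acyclic e -> forall J : {set vert G},
    [/\ (size (PU.1 J) <= #|J|.+1)%N, PU.2 J = (-1) ^+ #|J| *: (PU.1 J \Po - 'X),
      (PU.2 J).[0] = (J == finset.set0)%:R &
      forall N q, (q <= N.+1)%N ->
        (PU.1 J).[q%:R] = #|order_maps (arrow_rel e) N true q J|%:R /\
        (PU.2 J).[q%:R] = #|order_maps (arrow_rel e) N false q J|%:R].
  have [ace|nace] := boolP (is_acyclic e); last by exists (fun=> 0, fun=> 0).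
  have [P [U PUP]] := order_polynomial_reciprocity (arrow_rel_acyclic hG ace).
  by exists (P, U).
have {PU}[PU PU_spec] := fin_all_exists PU.
pose P e := (PU e).1; pose U e := (PU e).2.
have classE rep (c : {set orientation G}) : is_rep rep -> c \in ac_classes G ->
    is_acyclic (rep c) /\ c = ac_class (rep c).
  move=> repP cP; have [ace cE] := mem_ac_class hG cP (repP c cP).
  by split=> //; apply/setP => r; rewrite cE finset.inE.
exists (strict_poly U (acyclics G)), (weak_poly U (acyclics G)),
  (fun e => strict_poly U (ac_class e)), (fun e => weak_poly U (ac_class e)).
have sum_weak rep : is_rep rep ->
    weak_poly U (acyclics G) = \sum_(c in ac_classes G) weak_poly U (ac_class (rep c)).
  move=> repP; rewrite weak_poly_acyclics //; apply: eq_bigr => c cP.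
  by have [_ <-] := classE rep c repP cP.
have size_weak : size (weak_poly U (acyclics G)) = (rk G).+1.
  exact: (size_weak_poly hG (P := P) PU_spec).
split; [|split; [|split; [|split; [|split; [|split; [|split]]]]]].
- by case=> // N A e _ cA; apply: (strict_poly_nz hG (P := P) PU_spec).
- case=> // N rep _ repP; rewrite tau_bar_count_box // (sum_weak rep) // horner_sum natr_sum.
  apply: eq_bigr => c cP; have [ace _] := classE rep c repP cP.
  exact: (weak_poly_box hG (P := P) PU_spec).
- rewrite size_scale ?expf_neq0 ?oppr_eq0 ?oner_eq0 //.
  by rewrite size_comp_poly2 // size_polyN size_polyX.
- exact: size_weak.
- move=> e ace; split; case=> // N _.
    rewrite (lattice_points_box hG (s := true) (e := e)) //.
    exact: (strict_poly_box hG (P := P) PU_spec).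
  rewrite (lattice_points_box hG (s := false) (e := e)) //.
  exact: (weak_poly_box hG (P := P) PU_spec).
- move=> rep repP; split; last exact: sum_weak.
  rewrite /strict_poly (sum_weak rep) // linear_sum scaler_sumr.
  by apply: eq_bigr.
- by rewrite /strict_poly comp_polyZ -comp_polyA raddfN /= comp_polyX opprK comp_polyXr.
(* The two signs cancel, and each class contributes the value 1 of its weak polynomial at 0. *)
rewrite hornerZ mulrA -expr2 sqrr_sign mul1r horner_comp !hornerE oppr0.
rewrite weak_poly_acyclics // horner_sum -sum1_card natr_sum; apply: eq_bigr => c cP.
have [e [_ ace ->]] := class_ac_class hG cP.
exact: (weak_poly0 hG (P := P) PU_spec).
Qed.
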